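(* Let $n\ge 3$ and $G=\mathrm{Hol}(C_{2^n})$. For $m\ge1$ let $\Phi_m(X)$ denote the $m$-th cyclotomic polynomial. Then: 1. The set of all inequivalent irreducible $\mathbb{Q}$-representations of $G$ whose kernels contain $G'$ is in bijective correspondence with the Galois conjugacy classes (over $\mathbb{Q}$) of complex degree $1$ representations of $G$. The number of such irreducible $\mathbb{Q}$-representations is equal to $4(n-1)$. 2. The set of all inequivalent irreducible $\mathbb{Q}$-representations of $G$ whose kernels do not contain $G'$ is in bijective correspondence with the family of all monic irreducible polynomials $\Phi_1(X),\Phi_2(X),\dots,\Phi_{2^{n-k}}(X)$, where $k$ runs over $\{2,\dots,n\}$; that is, with the set of pairs $(k,\Phi_{2^j}(X))$ with $2\le k\le n$ and $0\le j\le n-k$. 3. The total number of inequivalent irreducible $\mathbb{Q}$-representations of $G$ equals $4(n-1)+\frac{n(n-1)}{2}$.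
   Context: $C_m$ is the cyclic group of order $m$; $\mathrm{Hol}(C_m)=C_m\rtimes\mathrm{Aut}(C_m)$ for the natural action; $G'$ is the commutator subgroup of $G$. Two irreducible complex representations of $G$ with characters $\chi,\chi'$ are Galois conjugate over $\mathbb{Q}$ if $\chi'=\sigma\circ\chi$ for some $\sigma\in\mathrm{Gal}(\mathbb{Q}(\chi)/\mathbb{Q})$, where $\mathbb{Q}(\chi)$ is the field generated by the values of $\chi$. *)

(* Defs.v *)
From HB Require Import structures.
From mathcomp Require Import all_boot all_order all_algebra.
From mathcomp Require Import all_fingroup all_solvable all_field all_character.
From mathcomp Require Import complex.
From mathcomp Require Import all_classical all_reals.

Set Implicit Arguments.
Unset Strict Implicit.
Unset Printing Implicit Defensive.

Import GRing.Theory Num.Theory.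
Local Open Scope classical_set_scope.
Local Open Scope ring_scope.

Definition Hol (gT : finGroupType) (A : {group gT}) : finGroupType :=
  sdprod_by [Aut A]%gact.

(* Zp m, unlike the full group [set: 'Z_m], has order m for every m > 0. *)
Definition HolC (m : nat) : {group Hol (Zp_group m)} := [set: Hol (Zp_group m)]%G.

Section Representations.
Variables (F : fieldType) (gT : finGroupType) (G : {group gT}).

Record rep := Rep { rep_deg : nat; rep_mx :> mx_representation F G rep_deg }.

Definition iso_class (rho : rep) : set rep :=
  [set rho' : rep | mx_rsim rho rho'].

Definition irr_reps : set rep := [set rho : rep | mx_irreducible rho].

Definition irr_classes (P : set rep) : set (set rep) :=
  iso_class @` (irr_reps `&` P).

Definition ker_contains (D : {set gT}) : set rep :=
  [set rho : rep | D \subset rker rho].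

Definition rep_char (rho : rep) (g : gT) : F := \tr (rho g).

Definition constituent (sigma rho : rep) : Prop :=
  irr_reps sigma /\
  exists (U : 'M[F]_(rep_deg rho)) (modU : mxmodule rho U),
    mx_rsim sigma (submod_repr modU).

End Representations.

Section GaloisConjugacy.
Variables (R : realType) (gT : finGroupType) (G : {group gT}).
Local Notation C := R[i].
Local Notation repC := (rep C G).

Definition char_field (chi : gT -> C) : set C :=
  smallest (fun K : set C => GRing.divring_closed (fun x => x \in K))
           (chi @` [set` G]).

(* Only the restriction of s to K is constrained. *)
Definition is_gal_over_rat (K : set C) (s : C -> C) : Prop :=
  [/\ set_bij K K s,
      {in K &, {morph s : x y / x + y}},
      {in K &, {morph s : x y / x * y}} &
      forall q : rat, s (ratr q) = ratr q].

Definition galois_conjugate (rho rho' : repC) : Prop :=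
  exists2 s : C -> C, is_gal_over_rat (char_field (rep_char rho)) s &
    forall g, g \in G -> rep_char rho' g = s (rep_char rho g).

Definition galois_class (rho : repC) : set repC :=
  [set rho' : repC | irr_reps rho' /\ galois_conjugate rho rho'].

Definition degree1_galois_classes : set (set repC) :=
  galois_class @` [set rho : repC | rep_deg rho = 1%N].

Definition complexify (rho : rep rat G) : repC :=
  Rep (map_repr (ratr : {rmorphism rat -> C}) rho).

(* The irreducible complex constituents of the members of X; for X an
   isomorphism class, these are the constituents of any one of its members. *)
Definition complex_constituents (X : set (rep rat G)) : set repC :=
  [set sigma : repC | exists2 rho, X rho & constituent sigma (complexify rho)].

End GaloisConjugacy.
Arguments degree1_galois_classes R {gT} G.
Arguments complex_constituents R {gT G} X.

(* Main.v *)
(* Write x for the generator of C_(2^n), and s, t for its automorphisms 5 and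
   -1; these generate Hol(C_(2^n)). By Schur's lemma an element of 2-power order
   in the centre of the image of an irreducible Q-representation is 1 or
   satisfies X^(2^i) + 1 = 0 for some i. If G' = <x^2> acts trivially, the image
   is abelian, and x = +-1, t = +-1 and the order of s form the type of the
   representation. Otherwise x satisfies X^(2^(k-1)) + 1 = 0 with k > 1, the
   power of s generating the centraliser of x mod x^(2^k) is central in the
   image, and k and the order of that power form the type.
   The type determines the character up to a factor, hence the representation:
   a group element whose image is not a sign times a power of the central
   element (of s in the abelian case) anticommutes with an invertible element of
   the image, so it has trace 0; and since X^(2^i) + 1 is irreducible over Q, a
   matrix satisfying it has characteristic polynomial a power of it.
   Every type occurs in the regular representation. The degree 1 complex
   representations of a given type form one Galois class, and they are the
   constituents of the rational representation of that type. *)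
Require Import Defs.
From HB Require Import structures.
From mathcomp Require Import all_boot all_order all_algebra.
From mathcomp Require Import all_fingroup all_solvable all_field all_character.
From mathcomp Require Import complex zify ring.
From mathcomp Require Import all_classical all_reals.

Set Implicit Arguments.
Unset Strict Implicit.
Unset Printing Implicit Defensive.

Import GRing.Theory Num.Theory.
Local Open Scope classical_set_scope.
Local Open Scope card_scope.
Local Open Scope nat_scope.

(** * Generators and a normal form for the holomorph of a cyclic group of order [2 ^ n] *)

(** [hg_inj] states uniqueness of the normal form at the identity only, which is what reading off
    the coefficient of the identity in the group algebra requires. *)
Record hol_gens (gT : finGroupType) (G : {group gT}) (n : nat) (x s t : gT) :
    Prop := HolGens {
  hg_x : x \in G; hg_s : s \in G; hg_t : t \in G;
  hg_xs : (x ^ s = x ^+ 5)%g; hg_xt : (x ^ t = x^-1)%g; hg_st : commute s t;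
  hg_ox : (x ^+ (2 ^ n) = 1)%g;
  hg_os : (s ^+ (2 ^ (n - 2)) = 1)%g;
  hg_ot : (t ^+ 2 = 1)%g;
  hg_gen : forall g, g \in G ->
    exists a b c, (g = x ^+ a * t ^+ b * s ^+ c)%g;
  hg_inj : forall a b c, a < 2 ^ n -> b < 2 -> c < 2 ^ (n - 2) ->
    (x ^+ a * t ^+ b * s ^+ c = 1)%g -> [/\ a = 0, b = 0 & c = 0] }.

Lemma expg1_small (gT : finGroupType) (y : gT) (k : nat) :
  k < #[y]%g -> (y ^+ k = 1)%g -> k = 0.
Proof.
move=> k_lt /eqP; rewrite -order_dvdn => dvd.
by apply/eqP; rewrite -leqn0 leqNgt; apply: contraTN dvd => k0; rewrite gtnNdvd.
Qed.

(** The automorphism group of a cyclic group of order [2 ^ n] is the direct product of the subgroups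
    generated by [5], of order [2 ^ (n - 2)], and by [-1]. Both factors are carried into the
    semidirect product by its canonical embeddings, whose images meet trivially. *)
Lemma Hol_cyclic2_gens (gT : finGroupType) (P : {group gT}) (n : nat) :
  3 <= n -> cyclic P -> #|P| = 2 ^ n ->
  exists x s t, hol_gens [set: Hol P]%G n x s t.
Proof.
move=> hn cycP oP; rewrite /Hol.
have pP : (2.-group P)%g by rewrite /pgroup oP pnatX pnat_id.
have q1 : 1 < 2 ^ n by rewrite -{1}(expn0 2) ltn_exp2l //; lia.
have ntP : P :!=: 1%g by rewrite -cardG_gt1 oP.
have [m [[act _ [inj_m _] mX mV] [cAA _ _ _]]] :=
  cyclic_pgroup_Aut_structure pP cycP ntP.
have -> : (logn 2 #|P|).-1 = n.-1 by rewrite oP pfactorK.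
(* The automorphism group has a degenerate shape for [n = 1], excluded here, and for [n = 2],
   excluded two lines below. *)
case: eqP => [|_]; first by lia.
case=> t [At ot mt] /=.
case: eqP => [|_]; first by lia.
case=> s [As os ms defA _].
have /cyclicP [z defP] := cycP.
have Pz : z \in P by rewrite defP cycle_id.
have oz : #[z]%g = 2 ^ n by rewrite /order -defP oP.
have sz : s z = (z ^+ 5)%g.
  have q5 : 5 < 2 ^ n by apply: (@leq_trans (2 ^ 3)) => //; rewrite leq_exp2l.
  by rewrite -act // ms val_Zp_nat oP // modn_small.
have tz : t z = (z^-1)%g.
  rewrite -act // mt /= Zp_cast ?oP // (modn_small q1) modn_small; last by lia.
  apply/eqP; rewrite eq_sym eq_invg_mul -expgS subn1 -oz.
  by rewrite prednK ?order_gt0 // expg_order.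
pose f1 := sdpair1_morphism [Aut P]%gact;
  pose f2 := sdpair2_morphism [Aut P]%gact.
have act' a : a \in Aut P -> (f1 z ^ f2 a = f1 (a z))%g.
  by move=> Aa; rewrite -sdpair_act //= /autact /= actbyE.
have inj1 : ('injm f1)%g := injm_sdpair1 _.
have inj2 : ('injm f2)%g := injm_sdpair2 _.
have ots : #[t]%g = 2 /\ #[s]%g = 2 ^ (n - 2).
  by split=> //; rewrite os; congr (2 ^ _); lia.
have [_ defA' _ tiA] := dprodP defA.
have cst : commute s t by apply: (centsP cAA).
exists (f1 z), (f2 s), (f2 t); split.
- exact: finset.in_setT.
- exact: finset.in_setT.
- exact: finset.in_setT.
- by apply: (etrans (act' s As)); rewrite sz morphX.
- by apply: (etrans (act' t At)); rewrite tz morphV.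
- by rewrite /commute -!morphM // cst.
- by rewrite -morphX // -oz expg_order morph1.
- by rewrite -morphX // -ots.2 expg_order morph1.
- by rewrite -morphX // -ots.1 expg_order morph1.
- move=> g _.
  have : g \in (f1 @* P * f2 @* Aut P)%g
    by rewrite (im_sdpair [Aut P]%gact) inE.
  case/mulsgP=> _ _ /morphimP[y Py _ ->] /morphimP[a Aa _ ->] ->.
  move: Py; rewrite {1}defP => /cycleP[i ->].
  move: Aa; rewrite -{1}defA' => /mulsgP[_ _ /cycleP[c ->] /cycleP[b ->] ->].
  exists i, b, c.
  have -> : (s ^+ c * t ^+ b = t ^+ b * s ^+ c)%g by apply: commuteX2.
  by rewrite morphM ?groupX // !morphX // mulgA.
move=> a b c la lb lc.
rewrite -!morphX // -mulgA -morphM ?groupX // => e.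
have : f1 (z ^+ a)%g \in (f1 @* P :&: f2 @* Aut P)%g.
  rewrite inE mem_morphim ?groupX //=.
  have -> : (f1 (z ^+ a) = (f2 (t ^+ b * s ^+ c))^-1)%g
    by apply: (mulIg (f2 (t ^+ b * s ^+ c)))%g; rewrite mulVg.
  by rewrite groupV mem_morphim ?groupM ?groupX.
rewrite (im_sdpair_TI [Aut P]%gact) => /set1P e1.
move: e; rewrite e1 mul1g => e2.
have a0 : a = 0.
  apply: (@expg1_small _ z); first by rewrite oz.
  by apply: (injmP inj1); rewrite ?groupX ?group1 // morph1.
have e3 : (t ^+ b * s ^+ c = 1)%g.
  by apply: (injmP inj2); rewrite ?groupM ?groupX ?group1 // morph1.
have : (s ^+ c \in <[s]> :&: <[t]>)%g.
  rewrite inE mem_cycle.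
  have -> : (s ^+ c = (t ^+ b)^-1)%g by apply/eqP;
    rewrite eq_sym eq_invg_mul e3.
  by rewrite groupV mem_cycle.
rewrite tiA => /set1P sc1; move: e3; rewrite sc1 mulg1 => tb1.
by split=> //; [apply: (@expg1_small _ t);
  rewrite ?ots.1 | apply: (@expg1_small _ s); rewrite ?ots.2].
Qed.

Lemma HolC_gens (n : nat) :
  3 <= n -> exists x s t, hol_gens (HolC (2 ^ n)) n x s t.
Proof.
move=> hn; apply: Hol_cyclic2_gens => //.
- suff -> : gval (Zp_group (2 ^ n)) = <[Zp1]>%g by apply: cycle_cyclic.
  rewrite -Zp_cycle /= /Zp ifT // -{1}(expn0 2) ltn_exp2l //; lia.
- by rewrite card_Zp // expn_gt0.
Qed.

(** * Cyclotomic polynomials of 2-power index and the matrices they annihilate *)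

Local Open Scope ring_scope.

(* For [j > 0] the equation says that [c] is a root of [Phi_(2 ^ j)]. *)
Definition ord2 (S : pzRingType) (j : nat) (c : S) : Prop :=
  if j is i.+1 then c ^+ (2 ^ i) = -1 else c = 1.

(** The cyclotomic polynomial [Phi_(2 ^ j)], written out over any ring. *)
Definition Psi (S : nzRingType) (j : nat) : {poly S} :=
  if j is i.+1 then 'X^(2 ^ i) + 1 else 'X - 1.

Lemma Psi_size (S : nzRingType) j :
  size (Psi S j) = (if j is i.+1 then 2 ^ i else 1).+1%N.
Proof.
case: j => [|i] /=; first by rewrite size_XsubC.
by rewrite -[1]polyC1 size_XnaddC // expn_gt0.
Qed.

Lemma Psi_monic (S : nzRingType) j : Psi S j \is monic.
Proof.
case: j => [|i] /=; first by rewrite monicXsubC.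
by rewrite -[1]polyC1 monicXnaddC // expn_gt0.
Qed.

Lemma map_Psi (S S' : nzRingType) (f : {rmorphism S -> S'}) j :
  map_poly f (Psi S j) = Psi S' j.
Proof.
case: j => [|i] /=; first by rewrite rmorphB rmorph1 /= map_polyX.
by rewrite rmorphD rmorph1 /= map_polyXn.
Qed.

Lemma root_Psi (S : comNzRingType) j (c : S) : root (Psi S j) c <-> ord2 j c.
Proof.
rewrite /root; case: j => [|i] /=; rewrite !hornerE.
  by split=> [/eqP/subr0_eq|->]; rewrite ?subrr.
by rewrite addr_eq0; split=> /eqP.
Qed.

Lemma horner_mx_Psi (S : comNzRingType) d (M : 'M[S]_d.+1) j :
  horner_mx M (Psi S j) = 0 <-> ord2 j M.
Proof.
case: j => [|i] /=.
  rewrite rmorphB rmorph1 /= horner_mx_X.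
  by split=> [/subr0_eq|->]; rewrite ?subrr.
rewrite rmorphD rmorph1 rmorphXn /= horner_mx_X.
split=> [/eqP|->]; last by rewrite addNr.
by rewrite addr_eq0 => /eqP.
Qed.

Lemma ord2_pow (S : pzRingType) j (c : S) : ord2 j c -> c ^+ (2 ^ j) = 1.
Proof.
case: j => [|i] /=; first by move->; rewrite expr1n.
by rewrite expnSr exprM => ->; rewrite expr2 mulrNN mulr1.
Qed.

Lemma ord2_pow_ge (S : pzRingType) j i (c : S) :
  ord2 j c -> (j <= i)%N -> c ^+ (2 ^ i) = 1.
Proof.
by move=> /ord2_pow cj /subnKC <-; rewrite expnD exprM cj expr1n.
Qed.

Lemma neqN11 (F : numDomainType) : -1 != 1 :> F.
Proof. by rewrite -subr_eq0 -opprD oppr_eq0 (pnatr_eq0 F 2). Qed.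

Lemma ord2_uniq (S : pzRingType) i j (c : S) :
  (-1 != 1 :> S) -> ord2 i c -> ord2 j c -> i = j.
Proof.
move=> n11; wlog ij : i j / (i <= j)%N => [wl ci cj|].
  by case: (leqP i j) => [|/ltnW] /wl -> //.
move=> ci cj; apply/eqP; rewrite eqn_leq ij /= leqNgt.
apply: contraNN n11 => lt_ij; case: j => [|j] // in ij cj lt_ij *.
by rewrite -cj (ord2_pow_ge ci).
Qed.

Lemma ord2_expr_odd (S : pzRingType) j (c : S) m :
  odd m -> ord2 j c -> ord2 j (c ^+ m).
Proof.
move=> om; case: j => [|j] /=; first by move->; rewrite expr1n.
by move=> cj; rewrite -exprM mulnC exprM cj -signr_odd om expr1.
Qed.

(** The truncated subtraction is intended: for [j <= e] the power is 1, which is [ord2 0]. *)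
Lemma ord2_expr_pow (S : pzRingType) j (c : S) e :
  ord2 j c -> ord2 (j - e) (c ^+ (2 ^ e)).
Proof.
case: (leqP j e) => [je cj|ej].
  by move/eqP: (je) => -> /=; apply: (ord2_pow_ge cj).
rewrite -(subnSK ej); case: j => [|j] // in ej *;
  rewrite subSS /= -exprM -expnD.
by rewrite subnKC.
Qed.

Lemma ord2_expr (S : pzRingType) j (c : S) m : (0 < m)%N ->
  ord2 j c -> ord2 (j - logn 2 m) (c ^+ m).
Proof.
move=> m0 cj; have [r /[!coprime2n] r_odd {2}->] :=
  pfactor_coprime (isT : prime 2) m0.
rewrite mulnC exprM; apply: ord2_expr_odd => //; exact: ord2_expr_pow.
Qed.

Lemma prim_root_ord2 (F : fieldType) j (z : F) : -1 != 1 :> F ->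
  (2 ^ j).-primitive_root z -> ord2 j z.
Proof.
move=> n11 prim_z; case: j prim_z => [|j] prim_z /=.
  by have := prim_expr_order prim_z; rewrite expn0 expr1.
have : (z ^+ (2 ^ j)) ^+ 2 == 1 by rewrite -exprM -expnSr prim_expr_order.
rewrite sqrf_eq1 => /orP[z1|/eqP //]; have := prim_order_dvd prim_z (2 ^ j).
by rewrite z1 dvdn_Pexp2l // ltnn.
Qed.

Lemma ord2_prim_root (F : fieldType) j (z : F) : -1 != 1 :> F ->
  ord2 j z -> (2 ^ j).-primitive_root z.
Proof.
move=> n11 zj.
have [m prim_z m_dvd] := prim_order_exists (expn_gt0 2 j) (ord2_pow zj).
have [i _ Dm] := dvdn_pfactor _ _ (isT : prime 2) m_dvd.
rewrite {m}Dm in prim_z {m_dvd}.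
by rewrite (ord2_uniq n11 zj (prim_root_ord2 n11 prim_z)).
Qed.

(** A primitive [2 ^ j]-th root of unity is a root, and its minimal polynomial has the degree of
    [Psi rat j], so the two are associates. In any factorisation one factor vanishes at that root
    and so has full degree. *)
Lemma Psi_irreducible j : irreducible_poly (Psi rat j).
Proof.
have [z prim_z] := C_prim_root_exists (expn_gt0 2 j).
have n11 := neqN11 algC.
have zPsi : root (map_poly ratr (Psi rat j)) z.
  by rewrite map_Psi root_Psi; apply: prim_root_ord2.
have [p [Dp _] p_min] := minCpolyP z.
have sz_p : size p = size (Psi rat j).
  rewrite -(size_map_poly (ratr : rat -> algC)) -Dp
     (minCpoly_cyclotomic prim_z).
  rewrite size_cyclotomic Psi_size; case: (j) => [|i] //.
  by rewrite totient_pfactor // mul1n.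
have eqp_p : p %= Psi rat j by rewrite -dvdp_size_eqp -?p_min // sz_p.
have Psi0 : Psi rat j != 0 by rewrite monic_neq0 ?Psi_monic.
split=> [|q sz_q /dvdpP[r Dq]].
  by rewrite Psi_size ltnS; case: (j) => //= i; rewrite expn_gt0.
have [r0 q0] : r != 0 /\ q != 0.
  by move: Psi0; rewrite Dq mulf_eq0 negb_or => /andP.
move: zPsi; rewrite Dq rmorphM rootM !p_min -Dq => /orP[pr|pq].
  have := dvdp_leq r0 pr; have := size_mul r0 q0; rewrite -Dq sz_p.
  move: r0 q0 sz_q; rewrite -!size_poly_gt0 => + + /eqP.
  by case: (size r) => // a _; case: (size q) => // -[//|b] _ _ ->; lia.
by apply/andP; split; [rewrite Dq dvdp_mull | rewrite -(eqp_dvdl _ eqp_p)].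
Qed.

Lemma irreducible_root (F : fieldType) (C : fieldType) (f : {rmorphism F -> C})
    (p q : {poly F}) (a : C) :
  irreducible_poly p -> root (map_poly f p) a ->
  root (map_poly f q) a = (p %| q)%R.
Proof.
move=> irr_p pa; apply/idP/idP => [qa|/dvdpP[r ->]]; last first.
  by rewrite rmorphM rootM pa orbT.
apply: contraLR qa; rewrite -irreducible_poly_coprime // -(coprimep_map f) =>
  co.
exact: (coprimep_root co pa).
Qed.

(** Every eigenvalue in the closed field is a root of [p]. Hence [p] divides each nonconstant monic
    factor that is left over, and induction on the size divides it out. *)
Lemma char_poly_irreducible (F : fieldType) (C : closedFieldType)
    (f : {rmorphism F -> C}) d (M : 'M[F]_d.+1) (p : {poly F}) :
  irreducible_poly p -> p \is monic -> horner_mx M p = 0 ->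
  exists e, char_poly M = p ^+ e.
Proof.
move=> irr_p mon_p pM0.
have: forall a, root (map_poly f (char_poly M)) a -> root (map_poly f p) a.
  move=> a; rewrite map_char_poly -eigenvalue_root_char eigenvalue_root_min.
  apply: contraTT => pa; apply: contraNN pa => ma.
  have : mxminpoly (map_mx f M) %| map_poly f p.
    by apply: mxminpoly_min; rewrite -map_horner_mx pM0 map_mx0.
  by move/dvdpP=> [r ->]; rewrite rootM ma orbT.
have := char_poly_monic M; move: (char_poly M) => q.
have [m] := ubnP (size q); elim: m q => // m IH q szq mon_q sub.
have [sq1|sq1] := eqVneq (size q) 1%N.
  exists 0%N; rewrite expr0 (size1_polyC (eq_leq sq1)).
  by have := monicP mon_q; rewrite lead_coefE sq1 /= => ->.
have [a qa] : exists a, root (map_poly f q) a.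
  by apply/closed_rootP; rewrite size_map_poly.
have pq : (p %| q)%R by rewrite -(irreducible_root q irr_p (sub a qa)).
have /dvdpP[r Dq] := pq.
have mon_r : r \is monic by rewrite -(monicMr _ mon_p) -Dq.
have [e De] : exists e, r = p ^+ e.
  apply: IH => //; last by move=> b rb; apply: sub; rewrite Dq rmorphM rootM rb.
  rewrite ltnS in szq; apply: leq_trans szq;
    rewrite Dq size_Mmonic ?monic_neq0 //.
  by case: (size p) irr_p.1 => [|[|b]] // _; rewrite !addnS /= ltnS leq_addr.
by exists e.+1; rewrite exprSr -De.
Qed.

(** The mean of the primitive [2 ^ j]-th roots of unity, that is, the Moebius function over the
    totient at [2 ^ j]. *)
Definition ord2_trace (j : nat) : rat :=
  match j with 0%N => 1 | 1%N => -1 | _ => 0 end.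

Lemma mxtrace_ord2 d (M : 'M[rat]_d) j :
  ord2 j M -> \tr M = ord2_trace j * d%:R.
Proof.
case: d M => [|d] M Mj; first by rewrite mulr0 /mxtrace big_ord0.
case: j Mj => [|[|j]] /=.
- by move->; rewrite mxtrace1 mul1r.
- by rewrite expn0 expr1 => ->; rewrite raddfN /= mxtrace1 mulN1r.
set h := (2 ^ j.+1)%N => Mj; rewrite mul0r.
have [e De] : exists e, char_poly M = Psi rat j.+2 ^+ e.
  apply: (char_poly_irreducible (ratr : {rmorphism rat -> algC})).
  - exact: Psi_irreducible.
  - exact: Psi_monic.
  - exact/horner_mx_Psi.
have h1 : (1 < h)%N by rewrite -{1}(expn0 2) ltn_exp2l.
(* The characteristic polynomial is a polynomial in ['X^h] with [h > 1] dividing its degree, so the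
   coefficient just below the leading one, which is minus the trace, is 0. *)
have De' : char_poly M = (('X + 1) ^+ e) \Po 'X^h.
  by rewrite De rmorphXn rmorphD rmorph1 /= comp_polyX.
have dh : (h * e = d.+1)%N.
  by have := size_exp (Psi rat j.+2) e;
    rewrite -De size_char_poly Psi_size /= => <-.
apply: oppr_inj; rewrite -char_poly_trace // De' coef_comp_poly_Xn; last by lia.
rewrite oppr0 ifF //=; apply/negbTE/negP => hd.
have : (h %| d.+1)%N by rewrite -dh dvdn_mulr.
by rewrite -addn1 dvdn_addr // dvdn1; lia.
Qed.

(** This is the exact 2-adic valuation of [5 ^ m - 1], namely that of [m] plus 2. Squaring [1 + u]
    gives [1 + 2 * u + u ^ 2], which raises the valuation of the difference from 1 by one when 4
    divides [u]. *)
Lemma odd_lift2 (e c : nat) :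
  odd c -> exists2 r, odd r & (5 ^ (2 ^ e * c) = 1 + 2 ^ (e + 2) * r)%N.
Proof.
move=> oc; elim: e => [|e [r or IH]].
  rewrite mul1n add0n; elim: c {-2}c (leqnn c) oc => [|m IH] c.
    by rewrite leqn0 => /eqP ->.
  case: c => [|[|c]] // lec oc; first by exists 1%N.
  have [||r or E] := IH c; first by lia.
    by move: oc => /=; rewrite negbK.
  exists (6 + 25 * r)%N; first by rewrite oddD oddM or.
  by rewrite !expnS E; lia.
exists (r + 2 ^ e.+1 * r * r)%N; first by rewrite oddD or !oddM oddX.
have -> : (2 ^ e.+1 * c = 2 ^ e * c * 2)%N by rewrite expnS; lia.
rewrite expnM IH; have -> :
  (2 ^ (e.+1 + 2) = 2 * 2 ^ (e + 2))%N by rewrite addSn expnS.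
have -> : (2 ^ e.+1 = 2 * 2 ^ e)%N by rewrite expnS.
have -> : (2 ^ (e + 2) = 4 * 2 ^ e)%N by rewrite expnD mulnC.
by rewrite -mulnn; ring.
Qed.

(** * Schur's lemma for central elements of 2-power order *)

Section HolRep.

Variables (gT : finGroupType) (G : {group gT}) (n : nat) (x s t : gT).
Hypothesis H : hol_gens G n x s t.

Let Gx : x \in G := hg_x H.
Let Gs : s \in G := hg_s H.
Let Gt : t \in G := hg_t H.

Lemma conj_xs a c : (x ^+ a * s ^+ c = s ^+ c * x ^+ (a * 5 ^ c))%g.
Proof.
have xsc : (x ^ (s ^+ c) = x ^+ (5 ^ c))%g.
  elim: c => [|c IH]; first by rewrite conjg1.
  by rewrite expgS conjgM (hg_xs H) conjXg IH -expgM expnS mulnC.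
by rewrite conjgC conjXg xsc -expgM mulnC.
Qed.

Lemma conj_xt a : (x ^+ a * t = t * x ^- a)%g.
Proof. by rewrite conjgC conjXg (hg_xt H) expgVn. Qed.

Section Field.

Variable F : fieldType.

Section OneRep.

Variables (d : nat) (rG : mx_representation F G d).

Lemma repr_mx_expg g m : g \in G -> rG (g ^+ m)%g = rG g ^+ m.
Proof.
move=> Gg; elim: m => [|m IH]; first by rewrite expg0 repr_mx1 expr0.
by rewrite expgS repr_mxM ?groupX // IH exprS mulmxE.
Qed.

(** The matrix [c - 1] centralises the image, so it is 0 or can be cancelled from
    [(c - 1) * (c + 1) = 0]. *)
Lemma Schur_involution (c : 'M[F]_d) :
  mx_irreducible rG -> centgmx rG c -> c ^+ 2 = 1 -> c = 1 \/ c = -1.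
Proof.
move=> irr cent c2.
have [c1|c1] := eqVneq (c - 1) 0; first by left; apply: subr0_eq.
right; apply/eqP; rewrite -addr_eq0; apply/eqP.
have cent1 : centgmx rG (c - 1).
  apply/centgmxP => g Gg.
  by rewrite mulmxBl mulmxBr (centgmxP cent) // mul1mx mulmx1.
have uc := mx_Schur irr cent1 c1.
apply: (can_inj (mulKmx uc)); rewrite mulmx0.
by rewrite mulmxE -subr_sqr_1 c2 subrr.
Qed.

(** Descent on the exponent: the square root [c ^+ (2 ^ N)] of 1 is central, hence [-1], which
    settles [j = N.+1], or [1], which lowers the exponent. *)
Lemma Schur_ord2 (c : 'M[F]_d) N :
  mx_irreducible rG -> centgmx rG c -> c ^+ (2 ^ N) = 1 ->
  exists2 j, (j <= N)%N & ord2 j c.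
Proof.
move=> irr cent; elim: N => [|N IH] cN.
  by exists 0%N => //=; rewrite expn0 expr1 in cN.
have [||/IH[j jN cj]|cN1] := @Schur_involution (c ^+ (2 ^ N)) irr.
- apply/centgmxP => g Gg; elim: (2 ^ N)%N => [|m IHm].
    by rewrite expr0 mul1mx mulmx1.
  by rewrite exprS -mulmxE -mulmxA IHm !mulmxA (centgmxP cent).
- by rewrite -exprM -expnSr.
- by exists j => //; apply: leqW.
- by exists N.+1.
Qed.

Lemma centgmx_gens (c : 'M[F]_d) :
  c *m rG x = rG x *m c -> c *m rG s = rG s *m c -> c *m rG t = rG t *m c ->
  centgmx rG c.
Proof.
move=> cx cs ct; apply/centgmxP => g /(hg_gen H)[a [b [e ->]]].
have cX h m : h \in G -> c *m rG h = rG h *m c ->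
    c *m rG (h ^+ m)%g = rG (h ^+ m)%g *m c.
  move=> Gh ch; elim: m => [|m IH];
    first by rewrite expg0 repr_mx1 mulmx1 mul1mx.
  by rewrite expgS repr_mxM ?groupX // mulmxA ch -!mulmxA IH.
rewrite !repr_mxM ?groupM ?groupX // !mulmxA cX // -!mulmxA; congr (_ *m _).
by rewrite mulmxA cX // -!mulmxA cX.
Qed.

(** The image of [x] need not be central, but the same descent works: once [y = x ^+ (2 ^ N)]
    squares to 1 in the image, [y ^+ 5 = y] and [y^-1 = y] there, so [y] commutes with [s] and
    [t]. *)
Lemma irr_ord2_x : mx_irreducible rG -> exists2 k, (k <= n)%N & ord2 k (rG x).
Proof.
move=> irr; have : rG x ^+ (2 ^ n) = 1
  by rewrite -repr_mx_expg // (hg_ox H) repr_mx1.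
elim: {-2 4}n (leqnn n) => [|N IH] lN xN.
  by exists 0%N => //=; rewrite expn0 expr1 in xN.
have y2 : rG (x ^+ (2 ^ N))%g *m rG (x ^+ (2 ^ N))%g = 1%:M.
  by rewrite repr_mx_expg // mulmxE -expr2 -exprM -expnSr.
have [||/IH[|j jN cj]|xN1] := @Schur_involution (rG x ^+ (2 ^ N)) irr.
- rewrite -repr_mx_expg //; apply: centgmx_gens.
  + by rewrite -!repr_mxM ?groupX // -expgSr -expgS.
  + rewrite -!repr_mxM ?groupX // -{1}[s]expg1 conj_xs expg1 !repr_mxM ?groupX
      //.
    rewrite expgM expn1 (repr_mx_expg 5 (groupX (2 ^ N) Gx)); congr (_ *m _).
    have y2' : rG (x ^+ (2 ^ N))%g ^+ 2 = 1 by rewrite expr2 -mulmxE; exact: y2.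
    by rewrite exprS (exprM _ 2 2) y2' expr1n mulr1.
  + rewrite -!repr_mxM ?groupX // conj_xt !repr_mxM ?groupV ?groupX //;
      congr (_ *m _).
    rewrite repr_mxV ?groupX //; have u := repr_mx_unit rG (groupX (2 ^ N) Gx).
    by apply: (can_inj (mulKmx u)); rewrite mulmxV.
- by rewrite -exprM -expnSr.
- exact: ltnW.
- by exists j => //; apply: leqW.
- by exists N.+1.
Qed.

End OneRep.
End Field.
End HolRep.

(* [inl (e, b, j)] stands for the representations with [x = (-1) ^ e],
   [t = (-1) ^ b] and [s] of order [2 ^ j]; [inr (k, j)] for those in which [x]
   has order [2 ^ (n - k)] and the generator of the centraliser of [x] in
   [<s>] has order [2 ^ j]. *)
Definition hol_type (n : nat) : finType :=
  ((bool * bool * 'I_n.-1) + {k : 'I_n.-1 & 'I_k.+1})%type.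

(** The exponent of [s] is the order of 5 modulo [2 ^ (n - tag kj)]. *)
Definition has_type (gT : finGroupType) (G : {group gT}) (n : nat) (x s t : gT)
    (F : fieldType) (d : nat) (rG : mx_representation F G d) (i : hol_type n) :=
  match i with
  | inl (e, b, j) => [/\ ord2 e (rG x), ord2 b (rG t) & ord2 j (rG s)]
  | inr kj => ord2 (n - tag kj) (rG x) /\
      ord2 (tagged kj) (rG s ^+ (2 ^ (n - tag kj - 2)))
  end.

Lemma neqN11_mx (R : nzRingType) d :
  (0 < d)%N -> -1 != 1 :> R -> -1 != 1 :> 'M[R]_d.
Proof.
case: d => // d _; apply: contraNneq => /matrixP /(_ 0 0).
by rewrite !mxE /= => ->.
Qed.

(** * The type of an irreducible representation *)

Section HolTypes.

Variables (gT : finGroupType) (G : {group gT}) (n : nat) (x s t : gT).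
Hypotheses (hn : (3 <= n)%N) (H : hol_gens G n x s t).

Let Gx : x \in G := hg_x H.
Let Gs : s \in G := hg_s H.
Let Gt : t \in G := hg_t H.

Local Notation htype := (@has_type gT G n x s t _ _).

Section OneRep.

Variables (F : fieldType) (d : nat) (rG : mx_representation F G d).

(** The number [5 ^ (2 ^ (k - 2))] is 1 modulo [2 ^ k], and [x ^+ (2 ^ k)] acts trivially. *)
Lemma comm_gamma k : (1 < k)%N -> ord2 k (rG x) ->
  rG (s ^+ (2 ^ (k - 2)))%g *m rG x = rG x *m rG (s ^+ (2 ^ (k - 2)))%g.
Proof.
move=> k1 xk; have [r _] := odd_lift2 (k - 2)%N (isT : odd 1).
rewrite muln1 subnK // => E.
rewrite -!repr_mxM ?groupX // -{2}[x]expg1 (conj_xs H) mul1n E.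
have xr : (x ^+ (2 ^ k * r))%g \in rker rG.
  rewrite expgM groupX //; apply/rkerP; split; first exact: groupX.
  by rewrite repr_mx_expg // (ord2_pow xk).
case/rkerP: xr => _ xr1.
by rewrite expgD expg1 !repr_mxM ?groupM ?groupX // xr1 mulmx1.
Qed.

Lemma x_involution_comm :
  rG x ^+ 2 = 1 -> rG x *m rG s = rG s *m rG x /\ rG x *m rG t = rG t *m rG x.
Proof.
move=> x2; split.
  have := conj_xs H 1 1; rewrite !expg1 mul1n expn1 -repr_mxM // => ->.
  rewrite (repr_mxM rG Gs (groupX 5 Gx)) repr_mx_expg //; congr (_ *m _).
  by rewrite exprS (exprM _ 2 2) x2 expr1n mulr1.
have := conj_xt H 1; rewrite expg1 -repr_mxM // => ->.
rewrite (repr_mxM rG Gt) ?groupV // repr_mxV //; congr (_ *m _).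
have u := repr_mx_unit rG Gx.
by apply: (can_inj (mulKmx u)); rewrite mulmxV // mulmxE -expr2 x2.
Qed.

Lemma comm_st : rG s *m rG t = rG t *m rG s.
Proof. by rewrite -!repr_mxM // (hg_st H). Qed.

(** If [x] acts as a sign, then [s] and [t] act centrally and Schur's lemma applies to each.
    Otherwise it applies to the power of [s] from [comm_gamma]. *)
Lemma irr_has_type : mx_irreducible rG -> exists i, htype rG i.
Proof.
move=> irr; have [k kn xk] := irr_ord2_x H irr.
have sN : rG s ^+ (2 ^ (n - 2)) = 1
  by rewrite -repr_mx_expg // (hg_os H) repr_mx1.
have [k1|k1] := leqP k 1.
  have x2 : rG x ^+ 2 = 1 by rewrite -[2%N]expn1; apply: ord2_pow_ge xk k1.
  have [xs xt] := x_involution_comm x2.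
  have [||b b1 tb] := @Schur_ord2 _ _ _ _ rG (rG t) 1 irr.
  - by apply: (centgmx_gens H); rewrite ?comm_st.
  - by rewrite -repr_mx_expg // expn1 (hg_ot H) repr_mx1.
  have [|j jn sj] := @Schur_ord2 _ _ _ _ rG (rG s) (n - 2)%N irr _ sN.
  - by apply: (centgmx_gens H); rewrite ?comm_st.
  have jn' : (j < n.-1)%N by lia.
  exists (inl (k == 1%N, b == 1%N, Ordinal jn')); split => //=.
  - by move: xk; case: (k) k1 => [|[|]].
  - by move: tb; case: (b) b1 => [|[|]].
have [||j jn sj] := @Schur_ord2 _ _ _ _ rG
  (rG (s ^+ (2 ^ (k - 2)))%g) (n - k)%N irr.
- apply: (centgmx_gens H); first exact: comm_gamma.
  + by rewrite -!repr_mxM ?groupX // -expgS -expgSr.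
  + by rewrite -!repr_mxM ?groupX //; congr (rG _);
      apply/commute_sym/commuteX/commute_sym/(hg_st H).
- rewrite -repr_mx_expg ?groupX // -expgM -expnD.
  have -> : (k - 2 + (n - k) = n - 2)%N by lia.
  by rewrite (hg_os H) repr_mx1.
(* A type stores [n - k] in place of [k]; the condition [1 < k] becomes this bound. *)
have kn' : (n - k < n.-1)%N by lia.
exists (inr (Tagged (fun k : 'I_n.-1 => 'I_k.+1)
  (Ordinal (jn : j < (Ordinal kn').+1)%N))) => /=.
by rewrite subKn // -repr_mx_expg.
Qed.

Lemma has_type_uniq i i' : (0 < d)%N -> -1 != 1 :> F ->
  htype rG i -> htype rG i' -> i = i'.
Proof.
move=> d0 n11.
have n11M := neqN11_mx d0 n11.
have un := fun a b => @ord2_uniq _ a b _ n11M.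
case: i => [[[e b] j]|[k j]]; case: i' => [[[e' b'] j']|[k' j']] /=.
- move=> [xe tb sj] [/(un _ _ _ xe) Ee /(un _ _ _ tb) Eb /(un _ _ _ sj) Ej].
  by congr (inl (_, _, _)); [case: (e) (e') Ee => [] [] | case: (b) (b') Eb =>
    [] [] | apply: val_inj].
- move=> [xe _ _] [/(un _ _ _ xe)]; case: (e) => /=; have := ltn_ord k'; lia.
- move=> [xe _] [/(un _ _ _ xe)]; case: (e') => /=; have := ltn_ord k; lia.
move=> [xk sj] [/(un _ _ _ xk) Ek sj'].
have {Ek} Ek : k = k' by apply: val_inj => /=; have := ltn_ord k;
  have := ltn_ord k'; lia.
case: k' / Ek j' sj' => j' /(un _ _ _ sj) Ej.
by congr (inr (existT _ _ _)); apply: val_inj.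
Qed.

(** The commutator of [x] and [t] is [x ^- 2], so a kernel containing the derived group forces
    [x ^+ 2 = 1], impossible where [x] has order at least 4. Conversely, when [x] acts as a sign the
    images of the generators commute. *)
Lemma der_sub_rker : -1 != 1 :> F -> mx_irreducible rG ->
  (G^`(1)%g \subset rker rG) <-> exists i, htype rG (inl i).
Proof.
move=> n11 irr; have d0 : (0 < d)%N by have [] := (mx_irrP rG).1 irr.
split.
  have [[i|[k j]] //] := irr_has_type irr; first by exists i.
  move=> /= [xk _] /fintype.subsetP sub.
  have : (x ^- 2)%g \in rker rG.
    apply: sub; have -> : (x ^- 2 = [~ x, t])%g.
      by rewrite commgEl (hg_xt H) -expgVn expgS expg1.
    exact: mem_commg.
  rewrite groupV => /rkerP[_]; rewrite repr_mx_expg // => x2.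
  have : rG x ^+ (2 ^ (n - k).-1) = 1.
    have -> : ((n - k).-1 = (n - k - 2).+1)%N by have := ltn_ord k; lia.
    by rewrite expnS exprM x2 expr1n.
  have -> : rG x ^+ (2 ^ (n - k).-1) = -1.
    by move: xk; have -> : (n - k = (n - k).-1.+1)%N by have := ltn_ord k; lia.
  by move/eqP; rewrite (negPf (neqN11_mx d0 n11)).
case=> -[[e b] j] /= [xe tb sj].
have x2 : rG x ^+ 2 = 1.
  by rewrite -[2%N]expn1; apply: ord2_pow_ge xe _; case: (e).
have [xs xt] := x_involution_comm x2.
(* [centgmx_gens] is used twice: each generator commutes with the generators, hence with every [g];
   then every [g] commutes with the generators, hence with all of [G]. *)
have cG g : g \in G -> centgmx rG (rG g).
  move=> Gg; apply: (centgmx_gens H); apply/esym; move: g Gg; apply/centgmxP;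
    by apply: (centgmx_gens H); rewrite ?comm_st ?xs ?xt.
rewrite gen_subG; apply/fintype.subsetP => _ /imset2P[g h Gg Gh ->].
apply/rkerP; rewrite groupR //; split=> //.
have := centgmxP (cG g Gg) h Gh; rewrite -!repr_mxM // => E.
have -> : ([~ g, h] = (h * g)^-1 * (g * h))%g
  by rewrite commgEl /conjg invMg !mulgA.
by rewrite repr_mxM ?groupV ?groupM // E -repr_mxM ?groupV ?groupM // mulVg
  repr_mx1.
Qed.

End OneRep.

(** A type consists of equations between a power and [1] or [-1], and these pull back along an
    injective intertwiner. It serves for submodules and for isomorphisms. *)
Lemma has_type_sub (F : fieldType) d1 d2 (r1 : mx_representation F G d1)
    (r2 : mx_representation F G d2) (B : 'M_(d1, d2)) i :
  row_free B -> (forall g, g \in G -> r1 g *m B = B *m r2 g) ->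
  htype r2 i -> htype r1 i.
Proof.
move=> freeB homB.
have ordB g j : g \in G -> ord2 j (r2 g) -> ord2 j (r1 g).
  move=> Gg; case: j => [|j] /=.
    by move=> g1; apply: (row_free_inj freeB); rewrite homB // g1 mulmx1 mul1mx.
  rewrite -!repr_mx_expg // => gN; apply: (row_free_inj freeB).
  by rewrite homB ?groupX // gN mulmxN mulNmx mulmx1 mul1mx.
case: i => [[[e b] j]|kj] /=; first by case=> *; split; apply: ordB.
by case=> *; split; [apply: ordB | rewrite -repr_mx_expg //; apply: ordB;
  rewrite ?groupX ?repr_mx_expg].
Qed.

Lemma has_type_rsim (F : fieldType) d1 d2 (r1 : mx_representation F G d1)
    (r2 : mx_representation F G d2) i :
  mx_rsim r1 r2 -> htype r2 i -> htype r1 i.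
Proof. by case=> B _; apply: has_type_sub. Qed.

Lemma has_type_map (F F' : fieldType) (f : {rmorphism F -> F'}) d
    (rG : mx_representation F G d) i :
  htype rG i -> htype (map_repr f rG) i.
Proof.
have ordf g j : g \in G -> ord2 j (rG g) -> ord2 j (map_repr f rG g).
  move=> Gg; case: j => [|j] /=; first by rewrite map_reprE => ->;
    apply: map_mx1.
  by rewrite -!repr_mx_expg // map_reprE => ->; rewrite map_mxN map_mx1.
case: i => [[[e b] j]|kj] /=; first by case=> *; split; apply: ordf.
by case=> *; split; [apply: ordf | rewrite -repr_mx_expg //; apply: ordf;
  rewrite ?groupX ?repr_mx_expg].
Qed.

End HolTypes.

(** * Orthogonality, and isomorphism from proportional characters *)

Section Orthogonality.

Variables (F : fieldType) (gT : finGroupType) (G : {group gT}).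

Lemma hom_irr_rsim d d' (r : mx_representation F G d)
    (r' : mx_representation F G d') (B : 'M_(d, d')) :
  mx_irreducible r -> mx_irreducible r' ->
  (forall g, g \in G -> r g *m B = B *m r' g) -> B != 0 -> mx_rsim r r'.
Proof.
move=> /mx_irrP[d0 irr] /mx_irrP[d'0 irr'] homB B0.
have kerB0 : kermx B == 0.
  apply: contraNT B0 => kB0; have modk : mxmodule r (kermx B).
    by apply/mxmoduleP => g Gg;
      rewrite sub_kermx -mulmxA homB // mulmxA mulmx_ker mul0mx.
  have /row_fullP[K KB] := irr _ modk kB0.
  by rewrite -[B]mul1mx -KB -mulmxA mulmx_ker mulmx0.
have freeB : row_free B by rewrite -kermx_eq0.
have fullB : row_full B.
  have modB : mxmodule r' <<B>>%MS.
    apply/mxmoduleP => g Gg; rewrite (eqmxMr _ (genmxE B)) genmxE -homB //.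
    exact: submxMl.
  have := irr' _ modB; rewrite -mxrank_eq0 genmxE mxrank_eq0 => /(_ B0).
  by rewrite /row_full genmxE.
by exists B => //; rewrite -(eqP freeB) (eqP fullB).
Qed.

(** Summing [r g^-1 *m M *m r' g] over the group yields an intertwiner, which must be 0. For
    [M = delta_mx i j] its entry at [i], [j] is the sum of products of diagonal entries; adding over
    [i] and [j] gives the traces. *)
Lemma mxtrace_orthogonal d d' (r : mx_representation F G d)
    (r' : mx_representation F G d') :
  mx_irreducible r -> mx_irreducible r' -> ~ mx_rsim r r' ->
  \sum_(g in G) \tr (r g^-1%g) * \tr (r' g) = 0.
Proof.
move=> irr irr' nsim.
pose B M := \sum_(g in G) r g^-1%g *m M *m r' g.
have B0 M : B M = 0.
  apply/eqP; apply: contra_notT nsim => BM; apply: (hom_irr_rsim irr irr' _ BM).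
  move=> h Gh; rewrite /B mulmx_sumr mulmx_suml.
  rewrite (reindex_inj (mulIg h)) /=; apply: eq_big => g;
    first by rewrite groupMr.
  move=> Ggh; have Gg : g \in G by rewrite -(groupMr _ Gh).
  by rewrite invMg repr_mxM ?groupV // repr_mxM // !mulmxA -(repr_mxM r Gh)
    ?groupV // mulgV repr_mx1 mul1mx.
have -> : \sum_(g in G) \tr (r g^-1%g) * \tr (r' g) =
    \sum_i \sum_j B (delta_mx i j) i j.
  under [RHS]eq_bigr do under eq_bigr do rewrite summxE.
  under [RHS]eq_bigr do rewrite exchange_big /=.
  rewrite [RHS]exchange_big /=; apply: eq_bigr => g _.
  rewrite /mxtrace mulr_suml; apply: eq_bigr => i _.
  rewrite mulr_sumr; apply: eq_bigr => j _.
  rewrite -mulmxA !mxE (bigD1 i) //= [X in _ + X]big1 ?addr0.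
    rewrite mxE (bigD1 j) //= [X in _ + X]big1 ?addr0; last first.
      by move=> k kj; rewrite mxE (negPf kj) andbF mul0r.
    by rewrite mxE !eqxx mul1r.
  move=> k ki; rewrite mxE big1 ?mulr0 // => l _.
  by rewrite mxE (negPf ki) mul0r.
by rewrite big1 // => i _; rewrite big1 // => j _; rewrite B0 mxE.
Qed.

End Orthogonality.

(** Over the algebraic numbers, the sum is the group order times the norm of a nonzero character. *)
Lemma mxtrace_norm_neq0 (gT : finGroupType) (G : {group gT}) d
    (r : mx_representation rat G d) : (0 < d)%N ->
  \sum_(g in G) \tr (r g^-1%g) * \tr (r g) != 0.
Proof.
move=> d0; pose rC := map_repr (ratr : {rmorphism rat -> algC}) r.
have trC g : g \in G -> cfRepr rC g = ratr (\tr (r g)).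
  by move=> Gg; rewrite cfunE Gg mulr1n map_reprE trace_map_mx.
have : '[cfRepr rC] != 0.
  rewrite cfnorm_eq0; apply: contraTneq d0 => /cfunP /(_ 1%g).
  by rewrite cfRepr1 cfunE => /eqP; rewrite pnatr_eq0 => /eqP ->.
apply: contraNneq => sum0; rewrite cfdotE.
rewrite (_ : \sum_(g in G) _ = ratr (\sum_(g in G) \tr (r g^-1%g) * \tr (r g))).
  by rewrite sum0 rmorph0 mulr0.
rewrite rmorph_sum; apply: eq_bigr => g Gg.
by rewrite -char_inv ?cfRepr_char // rmorphM !trC ?groupV // mulrC.
Qed.

(** Without an isomorphism the mixed sum vanishes; by proportionality [d%:R / d'%:R] times it is the
    sum of [mxtrace_norm_neq0]. *)
Lemma proportional_char_rsim (gT : finGroupType) (G : {group gT}) d d'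
    (r : mx_representation rat G d) (r' : mx_representation rat G d') :
  mx_irreducible r -> mx_irreducible r' ->
  (forall g, g \in G -> exists c,
    \tr (r g) = c * d%:R /\ \tr (r' g) = c * d'%:R) ->
  mx_rsim r r'.
Proof.
move=> irr irr' tr_rr'; apply: contrapT => /(mxtrace_orthogonal irr irr').
have [d0 d'0] : (0 < d)%N /\ (0 < d')%N.
  by have [? _] := (mx_irrP r).1 irr; have [? _] := (mx_irrP r').1 irr'.
move=> sum0; have := mxtrace_norm_neq0 r d0; apply/negP; rewrite negbK.
have : (d%:R / d'%:R) * \sum_(g in G) \tr (r g^-1%g) * \tr (r' g) == 0
  by rewrite sum0 mulr0.
rewrite mulr_sumr; congr (_ == _); apply: eq_bigr => g Gg.
have [c [-> ->]] := tr_rr' g Gg.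
by rewrite mulrCA; congr (_ * _); field; rewrite pnatr_eq0 -lt0n.
Qed.

(** * Characters computed from the type *)

Lemma anticomm_mxtrace d (Y A : 'M[rat]_d) :
  Y \in unitmx -> Y *m A = - (A *m Y) -> \tr A = 0.
Proof.
move=> uY YA; have : \tr A = - \tr A.
  by rewrite -{1}(mulKmx uY A) YA mulmxN raddfN /= mxtrace_mulC mulmxK.
by move/eqP; rewrite -addr_eq0 -mulr2n mulrn_eq0 => /eqP.
Qed.

Lemma ord2_bool (S : pzRingType) (b : bool) (c : S) : ord2 b c -> c = (-1) ^+ b.
Proof. by case: b. Qed.

(** The exponent 0 is set apart because [logn 2 0] is 0, which would give the trace of the first
    power. *)
Definition ord2_power_trace (j m : nat) : rat :=
  if m == 0%N then 1 else ord2_trace (j - logn 2 m).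

Lemma mxtrace_ord2X d (M : 'M[rat]_d) j m :
  ord2 j M -> \tr (M ^+ m) = ord2_power_trace j m * d%:R.
Proof.
rewrite /ord2_power_trace; case: eqVneq => [-> _|m0 Mj].
  by rewrite expr0 mxtrace1 mul1r.
by apply: mxtrace_ord2; apply: ord2_expr; rewrite // lt0n.
Qed.

Section Traces.

Variables (gT : finGroupType) (G : {group gT}) (n : nat) (x s t : gT).
Hypotheses (hn : (3 <= n)%N) (H : hol_gens G n x s t).

Let Gx : x \in G := hg_x H.
Let Gs : s \in G := hg_s H.
Let Gt : t \in G := hg_t H.

Local Notation htype := (@has_type gT G n x s t _ _).

Section Vanishing.

Variables (d : nat) (r : mx_representation rat G d) (k : nat).
Hypothesis xk : ord2 k.+2 (r x).

Lemma repr_x_odd m : odd m -> r (x ^+ (2 ^ k.+1 * m))%g = -1.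
Proof.
by move=> om; rewrite repr_mx_expg // exprM xk -signr_odd om expr1.
Qed.

Lemma repr_xV_odd m : odd m -> r (x ^- (2 ^ k.+1 * m))%g = -1.
Proof.
move=> om; have := mulVmx (repr_mx_unit r (groupX (2 ^ k.+1 * m) Gx)).
by rewrite -repr_mxV ?groupX // repr_x_odd // mulmxN mulmx1 =>
  /(congr1 -%R) <-; rewrite opprK.
Qed.

Lemma mxtrace_mulz y z g : y \in G -> z \in G -> g \in G ->
  (y * g = g * (y * z))%g -> r z = -1 -> \tr (r g) = 0.
Proof.
move=> Gy Gz Gg E z1; apply: (@anticomm_mxtrace _ (r y));
  first exact: repr_mx_unit.
by rewrite -repr_mxM // E !repr_mxM ?groupM // z1 !mulmxN !mulmx1.
Qed.

(** Conjugation by [x ^+ i] with [i = 2 ^ k] multiplies the element by a power of [x] with exponent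
    [i * (5 ^ e + 1)] up to sign. Since [5 ^ e + 1] is 2 modulo 4, this power acts as [-1]. *)
Lemma mxtrace_odd_t a b e : odd b -> \tr (r (x ^+ a * t ^+ b * s ^+ e)%g) = 0.
Proof.
move=> ob; pose i := (2 ^ k)%N.
have [o oo E] : exists2 o, odd o & (i * 5 ^ e + i = 2 ^ k.+1 * o)%N.
  have [o E] : exists o, (5 ^ e = 1 + 4 * o)%N.
    elim: e => [|e [o E]]; first by exists 0%N.
    by exists (1 + 5 * o)%N; rewrite expnS E; lia.
  exists (1 + 2 * o)%N; first by rewrite oddD oddM.
  by rewrite E /i expnS; lia.
have tb : (t ^+ b = t)%g.
  by rewrite -(odd_double_half b) ob expgD -muln2 mulnC expgM (hg_ot H) expg1n
    mulg1.
apply: (@mxtrace_mulz (x ^+ i)%g (x ^- (i * 5 ^ e + i))%g);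
  rewrite ?groupV ?groupM ?groupX //; last by rewrite E repr_xV_odd.
rewrite tb expgD invMg mulKVg -!mulgA.
have -> : (s ^+ e * x ^- (i * 5 ^ e) = x ^- i * s ^+ e)%g.
  apply: (mulgI (x ^+ i)%g); rewrite mulKVg mulgA (conj_xs H).
  by rewrite -mulgA mulgV mulg1.
rewrite !mulgA -expgD addnC expgD; congr (_ * _)%g.
by rewrite -!mulgA (conj_xt H).
Qed.

Lemma mxtrace_s_ndvd a e : ~~ (2 ^ k %| e)%N -> \tr (r (x ^+ a * s ^+ e)%g) = 0.
Proof.
move=> ndvd; have e0 : (0 < e)%N by case: (e) ndvd; rewrite ?dvdn0.
have [m /[!coprime2n] om De] := pfactor_coprime (isT : prime 2) e0.
set f := logn 2 e in De; have fk : (f < k)%N.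
  rewrite ltnNge; apply: contraNN ndvd => kf.
  by rewrite De dvdn_mull // dvdn_Pexp2l.
(* The exponent [i] is chosen so that [i * (5 ^ e - 1)] is exactly [2 ^ k.+1] times an odd number;
   moving [x ^+ i] across the element then costs a factor [-1]. *)
have [q oq E] := odd_lift2 f om; pose i := (2 ^ (k - f.+1))%N.
have Ei : (i * 5 ^ e = i + 2 ^ k.+1 * q)%N.
  rewrite De mulnC [(m * _)%N]mulnC E mulnDl mul1n; congr addn.
  by rewrite /i mulnAC -expnD; congr (2 ^ _ * _)%N; lia.
apply: (@mxtrace_mulz (x ^+ i)%g (x ^+ (2 ^ k.+1 * q))%g);
  rewrite ?groupM ?groupX //; last by rewrite repr_x_odd.
by rewrite -expgD -Ei -mulgA -(conj_xs H) !mulgA -!expgD addnC.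
Qed.

Lemma anticomm_x_mxtrace a e y z : y \in G -> z \in G -> commute y (s ^+ e)%g ->
  (x ^+ a * y = y * x ^+ a * z)%g -> r z = -1 ->
  \tr (r (x ^+ a * s ^+ e)%g) = 0.
Proof.
move=> Gy Gz cys E z1; apply: (@anticomm_mxtrace _ (r y));
  first exact: repr_mx_unit.
have xy : r (x ^+ a)%g *m r y = - (r y *m r (x ^+ a)%g).
  by rewrite -!repr_mxM ?groupX // E (repr_mxM r _ Gz) ?groupM ?groupX // z1
    mulmxN mulmx1.
rewrite repr_mxM ?groupX // mulmxA -[r y *m _]opprK -xy mulNmx -!mulmxA.
congr (- (_ *m _)); rewrite -!repr_mxM ?groupX //; congr (r _); exact: cys.
Qed.

(** Let [2 ^ l] be the exact power of 2 in [a]. If [l = k], then [t] anticommutes with [x ^+ a], as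
    [x ^+ (2 * a)] acts as [-1]. If [l < k], then the power [c = 2 ^ (k - l.+1)] of [s] does, as
    [a * (5 ^ c - 1)] is an odd multiple of [2 ^ k.+1]. *)
Lemma mxtrace_x_ndvd a e : ~~ (2 ^ k.+1 %| a)%N ->
  \tr (r (x ^+ a * s ^+ e)%g) = 0.
Proof.
move=> ndvd; have a0 : (0 < a)%N by case: (a) ndvd; rewrite ?dvdn0.
have [m /[!coprime2n] om Da] := pfactor_coprime (isT : prime 2) a0.
set l := logn 2 a in Da; have lk : (l <= k)%N.
  rewrite -ltnS ltnNge; apply: contraNN ndvd => kl.
  by rewrite Da dvdn_mull // dvdn_Pexp2l.
have [lk'|kl] := ltnP l k; last first.
  have {lk kl} Dl : l = k by apply/eqP; rewrite eqn_leq lk.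
  apply: (@anticomm_x_mxtrace _ _ t (x ^- (2 ^ k.+1 * m))%g) => //.
  - by rewrite groupV groupX.
  - by apply: commuteX; apply/commute_sym/(hg_st H).
  - have -> : (2 ^ k.+1 * m = a + a)%N by rewrite {1 2}Da Dl expnS; lia.
    by rewrite expgD invMg mulgA mulgK (conj_xt H).
  - exact: repr_xV_odd.
have [q oq E] := odd_lift2 (k - l.+1) (isT : odd 1).
pose c := (2 ^ (k - l.+1))%N; rewrite muln1 in E.
apply: (@anticomm_x_mxtrace _ _ (s ^+ c)%g (x ^+ (2 ^ k.+1 * (m * q)))%g).
- exact: groupX.
- exact: groupX.
- exact: commuteX2.
- rewrite (conj_xs H) -mulgA -expgD; congr (_ * x ^+ _)%g.
  rewrite E mulnDr muln1; congr addn.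
  have -> : (k.+1 = l + (k - l.+1 + 2))%N by lia.
  by rewrite {1}Da !expnD; lia.
- by rewrite repr_x_odd // oddM om.
Qed.

End Vanishing.

(** The factor [c] is chosen before [d] and [r], so representations of one type have proportional
    characters. It is 0 unless the element acts as a sign times a power of [s] in the abelian case,
    or of the central power of [s] otherwise. *)
Lemma has_type_mxtrace (i : hol_type n) g : g \in G ->
  exists c, forall d (r : mx_representation rat G d),
    htype r i -> \tr (r g) = c * d%:R.
Proof.
move=> /(hg_gen H)[a [b [e ->]]]; case: i => [[[e0 b0] j]|[k j]].
  exists ((-1) ^+ (e0 * a + b0 * b)%N * ord2_power_trace j e) =>
    d r /= [xe tb sj].
  rewrite !repr_mxM ?groupM ?groupX // !repr_mx_expg //.
  rewrite (ord2_bool xe) (ord2_bool tb) -!exprM -mulrA -(mxtrace_ord2X e sj).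
  rewrite !mulmxE -exprD; case: (odd _) (signr_odd 'M[rat]_d (e0 * a + b0 * b))
    (signr_odd rat (e0 * a + b0 * b)) => <- <-.
  - by rewrite !expr1 !mulN1r raddfN.
  - by rewrite !expr0 !mul1r.
have [m Dm] : exists m, (n - k = m.+2)%N.
  by exists (n - k - 2)%N; have := ltn_ord k; lia.
have [ob|eb] := boolP (odd b).
  by exists 0 => d r /= [xk _]; rewrite mul0r (mxtrace_odd_t (k := m)) // -Dm.
have tb : (t ^+ b = 1)%g.
  by rewrite -(odd_double_half b) (negPf eb) -muln2 mulnC expgM (hg_ot H)
    expg1n.
rewrite tb mulg1.
have [/dvdnP[f ->]|ne] := boolP (2 ^ m %| e)%N; last first.
  by exists 0 => d r /= [xk _]; rewrite mul0r (mxtrace_s_ndvd (k := m)) // -Dm.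
have [/dvdnP[a' ->]|na] := boolP (2 ^ m.+1 %| a)%N; last first.
  by exists 0 => d r /= [xk _]; rewrite mul0r (mxtrace_x_ndvd (k := m)) // -Dm.
exists ((-1) ^+ a' * ord2_power_trace j f) => d r /=; rewrite Dm.
have -> : (m.+2 - 2 = m)%N by lia.
move=> [xk sj]; rewrite repr_mxM ?groupX // !repr_mx_expg //.
rewrite [(a' * _)%N]mulnC [(f * _)%N]mulnC !exprM xk -mulrA -(mxtrace_ord2X f
  sj).
rewrite mulmxE; case: (odd _) (signr_odd 'M[rat]_d a') (signr_odd rat a') =>
  <- <-.
- by rewrite !expr1 !mulN1r raddfN.
- by rewrite !expr0 !mul1r.
Qed.

Lemma has_type_inj d d' (r : mx_representation rat G d)
    (r' : mx_representation rat G d') (i : hol_type n) :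
  mx_irreducible r -> mx_irreducible r' -> htype r i -> htype r' i ->
  mx_rsim r r'.
Proof.
move=> irr irr' ri r'i; apply: proportional_char_rsim => // g Gg.
by have [c tr_c] := has_type_mxtrace i Gg; exists c; rewrite !tr_c.
Qed.

End Traces.

(** * Every type occurs over the rationals *)

Section Existence.

Variables (gT : finGroupType) (G : {group gT}).

(* If every irreducible representation killed the sum, so would the regular
   one, where the coefficient of the identity can be read off. *)
Lemma irr_sum_neq0 (I : finType) (w : I -> rat) (h : I -> gT) (i0 : I) :
  (forall i, h i \in G) -> (forall i, h i = 1%g -> i = i0) -> h i0 = 1%g ->
  w i0 != 0 ->
  exists d (r : mx_representation rat G d),
    mx_irreducible r /\ \sum_i w i *: r (h i) != 0.
Proof.
move=> Gh h_inj h1 w0; apply: contrapT => none.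
pose rho := regular_repr rat G; pose A := \sum_i w i *: rho (h i).
have rat'G : ([pchar rat]^'.-group G)%g.
  by apply/pgroupP => p _; rewrite inE /= pchar_num.
have A0 : A = 0.
  apply/eqP; have cl := mx_reducible_semisimple (mxmodule1 rho)
    (mx_Maschke_pchar rho rat'G).
  apply: (cl (A == 0)) => ss;
    suff : (1%:M <= kermx A)%MS by rewrite sub_kermx mul1mx.
  case: ss => J U W simU defU _; rewrite {}/W in defU.
  rewrite -defU; apply/sumsmx_subP => j _; rewrite sub_kermx.
  have simj := simU j; have modj := mxsimple_module simj.
  pose r := submod_repr modj.
  have irr : mx_irreducible r by apply/submod_mx_irr.
  have r0 : \sum_i w i *: r (h i) = 0.
    apply/eqP; apply: contra_notT none => r0; exists _, r; split=> //.
  rewrite -(eqmx_eq0 (eqmxMr A (val_submod1 (U j)))).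
  apply/eqP; rewrite -[RHS](linear0 (val_submod (U:=U j))) -r0 linear_sum
    [RHS]linear_sum /=.
  apply: eq_bigr => i _; rewrite !linearZ /= -(val_submodJ modj) ?mul1mx //.
(* By semisimplicity the sum acts as 0 on the regular module; its coefficient at the identity is
   [w i0]. *)
have := congr1 (@gring_proj rat gT G 1%g) A0;
  rewrite linear0 linear_sum (bigD1 i0) //=.
rewrite big1 ?addr0 => [|i ii0]; rewrite linearZ /= gring_projE ?group1 //.
  rewrite h1 eqxx => /matrixP /(_ 0 0); rewrite !mxE eqxx mulr1 => /eqP.
  by rewrite (negPf w0).
by case: eqP => [/esym/h_inj|_]; [move/eqP;
  rewrite (negPf ii0) | rewrite scaler0].
Qed.

End Existence.

Lemma prod_Psi (S : comNzRingType) N :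
  \prod_(i < N.+1) Psi S i = 'X^(2 ^ N) - 1.
Proof.
elim: N => [|N IH]; first by rewrite big_ord1.
by rewrite big_ord_recr /= IH expnSr exprM -[X in _ = _ - X](expr1n _ 2)
  subr_sqr.
Qed.

(** The cofactor of [Psi rat k] in ['X^(2 ^ N) - 1]. Evaluated at a matrix satisfying [ord2 i] with
    [i <= N], it can be nonzero only for [i = k]. *)
Definition Psi_cofactor (N k : nat) : {poly rat} :=
  \prod_(i < N.+1 | i != k :> nat) Psi rat i.

Lemma Psi_cofactorE N k : (k <= N)%N ->
  Psi rat k * Psi_cofactor N k = 'X^(2 ^ N) - 1.
Proof. by move=> kN; rewrite -prod_Psi (bigD1 (Ordinal (kN : k < N.+1)%N)). Qed.

Lemma Psi_cofactor_dvd N k i :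
  (i <= N)%N -> i != k -> (Psi rat i %| Psi_cofactor N k)%R.
Proof.
move=> iN ik; rewrite /Psi_cofactor (bigD1 (Ordinal (iN : i < N.+1)%N)) //=.
exact: dvdp_mulr.
Qed.

Lemma size_Psi_cofactor N k :
  (k <= N)%N -> (size (Psi_cofactor N k) <= 2 ^ N)%N.
Proof.
move=> kN; have mon : Psi_cofactor N k \is monic.
  by apply: monic_prod => i _; apply: Psi_monic.
have := congr1 (fun p : {poly rat} => size p) (Psi_cofactorE kN).
rewrite size_monicM ?Psi_monic ?monic_neq0 // size_XnsubC ?expn_gt0 //.
rewrite Psi_size; move: (size _) => z; case: k {mon kN} => [|k]; first by lia.
by have := expn_gt0 2 k; lia.
Qed.

Lemma Psi_cofactor0 N k : (Psi_cofactor N k)`_0 != 0.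
Proof.
rewrite -horner_coef0 horner_prod; apply/prodf_neq0.
move=> [[|i] /= _] _; rewrite !hornerE; first by [].
by rewrite expr0n eqn0Ngt expn_gt0 add0r oner_eq0.
Qed.

(** The sum runs over [a < m] to match the range of an exponent in the normal form of group
    elements. *)
Definition mxpoly_eval d (m : nat) (p : {poly rat}) (M : 'M[rat]_d) :
  'M[rat]_d :=
  \sum_(a < m) p`_a *: M ^+ a.

Lemma mxpoly_evalE d m (p : {poly rat}) (M : 'M[rat]_d.+1) :
  (size p <= m)%N -> mxpoly_eval m p M = horner_mx M p.
Proof.
move=> szp; have Dp : p = \poly_(a < m) p`_a.
  by apply/polyP => a; rewrite coef_poly;
    case: ltnP => // /(leq_trans szp)/(nth_default 0).
rewrite {2}Dp poly_def rmorph_sum; apply: eq_bigr => a _.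
by rewrite /= horner_mxZ rmorphXn /= horner_mx_X.
Qed.

Lemma mxpoly_eval_dvd d m i (p : {poly rat}) (M : 'M[rat]_d) :
  (0 < d)%N -> (size p <= m)%N ->
  (Psi rat i %| p)%R -> ord2 i M -> mxpoly_eval m p M = 0.
Proof.
case: d M => // d M _ szp /dvdpP[q Dp] /horner_mx_Psi Mi.
by rewrite mxpoly_evalE // Dp rmorphM /= Mi mulr0.
Qed.

Lemma mxpoly_eval_dvdX d m i c (p : {poly rat}) (M : 'M[rat]_d) : (0 < d)%N ->
  (size (p \Po 'X^c) <= m)%N ->
  (Psi rat i %| p)%R -> ord2 i (M ^+ c) -> mxpoly_eval m (p \Po 'X^c) M = 0.
Proof.
case: d M => // d M _ szp /dvdpP[q Dp] /horner_mx_Psi Mi.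
rewrite mxpoly_evalE // (_ : horner_mx M _ = horner_mx (M ^+ c) p).
  by rewrite Dp rmorphM /= Mi mulr0.
elim/poly_ind: (p) => [|u a IH]; first by rewrite comp_poly0 !rmorph0.
rewrite comp_polyD comp_polyM comp_polyX comp_polyC !rmorphD !rmorphM /= IH.
by rewrite !horner_mx_C horner_mx_X rmorphXn /= horner_mx_X.
Qed.

Section TypeExistence.

Variables (gT : finGroupType) (G : {group gT}) (n : nat) (x s t : gT).
Hypotheses (hn : (3 <= n)%N) (H : hol_gens G n x s t).

Let Gx : x \in G := hg_x H.
Let Gs : s \in G := hg_s H.
Let Gt : t \in G := hg_t H.

Local Notation htype := (@has_type gT G n x s t _ _).

(** The product of the three values expands into a combination of the elements
    [x ^+ a * t ^+ b * s ^+ e], in which the identity has coefficient the product of the constant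
    terms. By [irr_sum_neq0] some irreducible representation does not kill it. *)
Lemma irr_poly_neq0 (p q r : {poly rat}) :
  p`_0 != 0 -> q`_0 != 0 -> r`_0 != 0 ->
  exists d (rho : mx_representation rat G d), mx_irreducible rho /\
    [/\ mxpoly_eval (2 ^ n) p (rho x) != 0, mxpoly_eval 2 q (rho t) != 0
      & mxpoly_eval (2 ^ (n - 2)) r (rho s) != 0].
Proof.
move=> p0 q0 r0.
pose I := (('I_(2 ^ n) * 'I_2) * 'I_(2 ^ (n - 2)))%type.
pose w (i : I) := p`_i.1.1 * q`_i.1.2 * r`_i.2.
pose h (i : I) := (x ^+ i.1.1 * t ^+ i.1.2 * s ^+ i.2)%g.
pose i0 : I := (Ordinal (expn_gt0 2 n), ord0, Ordinal (expn_gt0 2 (n - 2))).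
have [||||d [rho [irr A0]]] := @irr_sum_neq0 _ G _ w h i0.
- by move=> i; rewrite !groupM ?groupX.
- move=> [[a b] e] /(hg_inj H (ltn_ord a) (ltn_ord b) (ltn_ord e)) [a0 b0 e0].
  by congr (_, _, _); apply: val_inj.
- by rewrite /h !expg0 !mulg1.
- by rewrite !mulf_neq0.
exists d, rho; split=> //.
have DA : \sum_i w i *: rho (h i) = mxpoly_eval (2 ^ n) p (rho x) *m
    mxpoly_eval 2 q (rho t) *m mxpoly_eval (2 ^ (n - 2)) r (rho s).
  rewrite -(pair_bigA _ (fun ab e => w (ab, e) *: rho (h (ab, e)))) /=.
  rewrite -(pair_bigA _ (fun a b => \sum_e w ((a, b), e) *:
    rho (h ((a, b), e)))) /=.
  have [R DR] : exists R, R = mxpoly_eval (2 ^ (n - 2)) r (rho s)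
    by exists (mxpoly_eval (2 ^ (n - 2)) r (rho s)).
  rewrite -DR /mxpoly_eval !mulmx_suml.
  apply: eq_bigr => a _.
  rewrite mulmx_sumr mulmx_suml; apply: eq_bigr => b _.
  rewrite DR /mxpoly_eval mulmx_sumr; apply: eq_bigr => e _.
  rewrite /h !repr_mxM ?groupM ?groupX // !repr_mx_expg //.
  rewrite -!scalemxAr -!scalemxAl !scalerA /w /=; congr (_ *: _); ring.
move: A0; rewrite DA => A0; split; apply: contraNneq A0 => ->.
- by rewrite !mul0mx.
- by rewrite mulmx0 mul0mx.
- by rewrite mulmx0.
Qed.

(** The polynomials are the cofactors belonging to the components of [i]. A representation on which
    they do not vanish has some type, and any component of it differing from that of [i] would make
    a cofactor vanish. *)
Lemma has_type_exists (i : hol_type n) :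
  exists d (rho : mx_representation rat G d), mx_irreducible rho /\ htype rho i.
Proof.
have gt0 d (rho : mx_representation rat G d) : mx_irreducible rho -> (0 < d)%N.
  by case/mx_irrP.
case: i => [[[e b] j]|[k j]].
  have le1 (c : bool) : (c <= 1)%N by case: c.
  have [d [rho [irr [px qt rs]]]] := irr_poly_neq0 (Psi_cofactor0 n e)
    (Psi_cofactor0 1 b) (Psi_cofactor0 (n - 2) j).
  exists d, rho; split=> //; have d0 := gt0 _ _ irr.
  have jn : (j <= n - 2)%N by have := ltn_ord j; lia.
  have en (c : bool) : (c <= n)%N by apply: leq_trans (le1 c) _; lia.
  have [[[[e' b'] j']|[k j']] /=] := irr_has_type hn H irr.
    move=> [xe tb sj]; have [Ee|ne] := eqVneq (nat_of_bool e') e; last first.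
      case/eqP: px; apply: (mxpoly_eval_dvd (i := e')) => //.
      - exact: size_Psi_cofactor.
      - exact: Psi_cofactor_dvd.
    have [Eb|nb] := eqVneq (nat_of_bool b') b; last first.
      case/eqP: qt; apply: (mxpoly_eval_dvd (i := b')) => //.
      - exact: size_Psi_cofactor.
      - exact: Psi_cofactor_dvd.
    have [Ej|nj] := eqVneq (j' : nat) j; last first.
      case/eqP: rs; apply: (mxpoly_eval_dvd (i := j')) => //.
      - exact: size_Psi_cofactor.
      - by apply: Psi_cofactor_dvd => //; have := ltn_ord j'; lia.
    by rewrite -Ee -Eb -Ej.
  move=> [xk _]; case/eqP: px; apply: (mxpoly_eval_dvd (i := n - k)) => //.
  - exact: size_Psi_cofactor.
  - apply: Psi_cofactor_dvd; first exact: leq_subr.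
    by have := le1 e; have := ltn_ord k; lia.
(* The condition concerns [s ^+ c], so the cofactor is composed with ['X^c]. It still fits the
   exponent range of [s] because [2 ^ (n - 2) = 2 ^ k * c]. *)
pose c := (2 ^ (n - k - 2))%N.
have c0 : (0 < c)%N by rewrite expn_gt0.
have kn := ltn_ord k; have jk := ltn_ord j.
have comp0 : (Psi_cofactor k j \Po 'X^c)`_0 != 0.
  by rewrite coef_comp_poly_Xn // dvdn0 div0n Psi_cofactor0.
have sz : (size (Psi_cofactor k j \Po 'X^c) <= 2 ^ (n - 2))%N.
  have := size_comp_poly (Psi_cofactor k j) 'X^c; rewrite size_polyXn /=.
  have -> : (2 ^ (n - 2) = 2 ^ k * c)%N by rewrite -expnD; congr (2 ^ _)%N; lia.
  have := size_Psi_cofactor (jk : (j <= k)%N); move: (size _) (size _) => u v.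
  by nia.
have [d [rho [irr [px _ rs]]]] := irr_poly_neq0 (Psi_cofactor0 n (n - k))
    (Psi_cofactor0 1 0) comp0.
exists d, rho; split=> //; have d0 := gt0 _ _ irr.
have [[[[e' b'] j']|[k' j']] /=] := irr_has_type hn H irr.
  move=> [xe _ _]; case/eqP: px; apply: (mxpoly_eval_dvd (i := e')) => //.
  - by apply: size_Psi_cofactor; apply: leq_subr.
  - by apply: Psi_cofactor_dvd; case: (e'); lia.
have kn' := ltn_ord k'; have jk' := ltn_ord j'.
(* The order of [x] is matched first, since it determines which power of [s] the condition [sj] is
   about. *)
move=> [xk sj]; have [Ek|nk] := eqVneq (k' : nat) k; last first.
  case/eqP: px; apply: (mxpoly_eval_dvd (i := n - k')) => //.
  - by apply: size_Psi_cofactor; apply: leq_subr.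
  - by apply: Psi_cofactor_dvd; lia.
move: (nat_of_ord j') jk' xk sj; rewrite Ek => m mk xk sj.
split=> //=; have [<- //|nj] := eqVneq m j.
case/eqP: rs; apply: (mxpoly_eval_dvdX (i := m)) => //.
exact: Psi_cofactor_dvd.
Qed.

End TypeExistence.

(** * Galois conjugation of roots of unity of 2-power order *)

Section Conjugate.

Variables (C : numClosedFieldType) (j : nat) (z z' : C).
Hypotheses (zj : ord2 j z) (z'j : ord2 j z').

Local Notation pC p := (map_poly (ratr : rat -> C) p).

Definition adjoin (a : C) : set C :=
  [set b | exists p : {poly rat}, b = (pC p).[a]].

(** The right side does not mention [a]: a rational polynomial vanishes at one root of [Psi] exactly
    when it vanishes at all of them. *)
Lemma ord2_horner_eq0 (p : {poly rat}) (a : C) :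
  ord2 j a -> (pC p).[a] = 0 <-> (Psi rat j %| p)%R.
Proof.
move=> aj; have root_a : root (pC (Psi rat j)) a by rewrite map_Psi;
  apply/root_Psi.
by rewrite -(irreducible_root p (Psi_irreducible j) root_a); split=> /eqP.
Qed.

Lemma adjoin_divring_closed : GRing.divring_closed (fun b => b \in adjoin z).
Proof.
split=> [|a b|a b].
- by apply: (@mem_set _ (adjoin z)); exists 1; rewrite rmorph1 hornerC.
- move=> /(@set_mem _ (adjoin z))[p ->] /(@set_mem _ (adjoin z))[q ->];
    apply: (@mem_set _ (adjoin z)); exists (p - q).
  by rewrite rmorphB hornerD hornerN.
- move=> /(@set_mem _ (adjoin z))[p ->] /(@set_mem _ (adjoin z))[q ->].
  apply: (@mem_set _ (adjoin z)).
  (* If the denominator is 0, so is the quotient, as the inverse of 0 is 0. Otherwise a Bezout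
     relation with [Psi rat j] gives the inverse as a polynomial in [z]. *)
  have [dvd|] := boolP (Psi rat j %| q)%R.
    have -> : (pC q).[z] = 0 by apply/(ord2_horner_eq0 _ zj).
    by exists 0; rewrite rmorph0 horner0 invr0 mulr0.
  rewrite -irreducible_poly_coprime; last exact: Psi_irreducible.
  case/Bezout_eq1_coprimepP => -[u v] /= E; exists (p * v).
  have : (pC (u * Psi rat j + v * q)).[z] = 1 by rewrite E rmorph1 hornerC.
  rewrite rmorphD !rmorphM !hornerE.
  have -> : (pC (Psi rat j)).[z] = 0 by apply/(ord2_horner_eq0 _ zj).
  rewrite mulr0 add0r => E1; congr (_ * _).
  have q0 : (pC q).[z] != 0.
    by apply/eqP => q0; move/eqP: E1; rewrite q0 mulr0 eq_sym oner_eq0.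
  by rewrite -[LHS]mul1r -E1 mulfK.
Qed.

Lemma adjoin_min (K : set C) :
  GRing.divring_closed (fun b => b \in K) -> z \in K -> adjoin z `<=` K.
Proof.
move=> [K1 KB KD] Kz.
have K0 : 0 \in K by rewrite -(subrr 1); apply: KB.
have KN a : a \in K -> - a \in K by move=> Ka; rewrite -sub0r; apply: KB.
have KA a b : a \in K -> b \in K -> a + b \in K.
  by move=> Ka Kb; rewrite -[b]opprK; apply: KB => //; apply: KN.
have KM a b : a \in K -> b \in K -> a * b \in K.
  move=> Ka Kb; rewrite -[b]invrK; apply: (KD a b^-1) => //.
  by rewrite -div1r; apply: KD.
have Kn m : (m%:R : C) \in K.
  by elim: m => // m IH; rewrite -addn1 natrD; apply: KA.
have Kz' (m : int) : (m%:~R : C) \in K.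
  by case: m => m; [exact: Kn | rewrite NegzE mulrNz; apply/KN/Kn].
have Kq (q : rat) : (ratr q : C) \in K by apply: KD.
move=> _ [p ->]; apply: set_mem; elim/poly_ind: p => [|p c IH].
  by rewrite rmorph0 horner0.
rewrite rmorphD rmorphM /= map_polyX map_polyC /= !hornerE.
by apply: KA => //; apply: KM.
Qed.

(** The root [z] is primitive, so [z'] is a power of it. *)
Lemma adjoin_conj : adjoin z' `<=` adjoin z.
Proof.
have prim_z := ord2_prim_root (neqN11 C) zj.
have [m Dz'] := prim_rootP prim_z (ord2_pow z'j).
move=> _ [p ->]; exists (p \Po 'X^m).
by rewrite map_comp_poly /= map_polyXn horner_comp hornerXn -Dz'.
Qed.

End Conjugate.

Section GaloisMap.

Variables (R : realType) (j : nat) (z z' : R[i]).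
Hypotheses (zj : ord2 j z) (z'j : ord2 j z').

Local Notation C := R[i].
Local Notation pC p := (map_poly (ratr : rat -> C) p).

(** The map sends [p(z)] to [p(z')]; [ord2_horner_eq0] at [z] and at [z'] makes it well defined and
    injective. *)
Lemma gal_conj_exists :
  exists2 f : C -> C, is_gal_over_rat (adjoin z) f &
    forall p : {poly rat}, f (pC p).[z] = (pC p).[z'].
Proof.
have [f fE] : exists f : C -> C,
    forall p : {poly rat}, f (pC p).[z] = (pC p).[z'].
  have /choice[f fE] : forall a : C, exists b : C, forall p : {poly rat},
      a = (pC p).[z] -> b = (pC p).[z'].
    (* Outside [adjoin z] the value is 0 by default. *)
    move=> a; have [[p Dp]|no] := pselect (adjoin z a); last first.
      by exists 0 => p Dp; case: no; exists p.
    exists (pC p).[z'] => q Dq; apply/eqP;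
      rewrite -subr_eq0 -hornerN -hornerD -rmorphB.
    apply/eqP/(ord2_horner_eq0 _ z'j)/(ord2_horner_eq0 _ zj).
    by rewrite rmorphB hornerD hornerN -Dp -Dq subrr.
  by exists f => p; apply: fE.
exists f => //; split.
- split.
  + by move=> _ [p ->]; rewrite fE; apply: (adjoin_conj zj z'j); exists p.
  + move=> _ _ /set_mem[p ->] /set_mem[q ->]; rewrite !fE => /eqP.
    rewrite -subr_eq0 -hornerN -hornerD -rmorphB =>
      /eqP/(ord2_horner_eq0 _ z'j).
    move/(ord2_horner_eq0 _ zj)/eqP; rewrite rmorphB hornerD hornerN subr_eq0.
    by move/eqP.
  + move=> a /(adjoin_conj z'j zj)[p ->]; exists (pC p).[z]; last exact: fE.
    by exists p.
- move=> _ _ /set_mem[p ->] /set_mem[q ->].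
  by rewrite -hornerD -rmorphD !fE rmorphD hornerD.
- move=> _ _ /set_mem[p ->] /set_mem[q ->].
  by rewrite -hornerM -rmorphM !fE rmorphM hornerM.
- by move=> q; have := fE q%:P; rewrite map_polyC !hornerC.
Qed.

End GaloisMap.

(** * Complex representations of abelian type *)

Lemma der_sub_rker_deg1 (gT : finGroupType) (G : {group gT})
    (C : closedFieldType)    d (r : mx_representation C G d) :
  mx_irreducible r -> G^`(1)%g \subset rker r -> d = 1%N.
Proof.
move=> irr sub; apply/eqP; rewrite -(der1_sub_rker _ irr) //.
exact: group_closure_closed_field.
Qed.

Lemma deg1_irr (gT : finGroupType) (G : {group gT}) (F : fieldType)
    d (r : mx_representation F G d) : d = 1%N -> mx_irreducible r.
Proof. by move=> d1; apply/mx_abs_irrW/linear_mx_abs_irr. Qed.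

Lemma irr_submod_exists (gT : finGroupType) (G : {group gT}) (F : fieldType)
    d (r : mx_representation F G d) : (0 < d)%N ->
  exists (U : 'M_d) (modU : mxmodule r U), mx_irreducible (submod_repr modU).
Proof.
move=> d0; have n10 : 1%:M != 0 :> 'M[F]_d.
  by rewrite -mxrank_eq0 mxrank1 -lt0n.
have cl := mxsimple_exists (mxmodule1 r) n10.
have /asboolP[U simU _] := cl `[< exists2 V, mxsimple r V & (V <= 1%:M)%MS >]
  (fun e => asboolT e).
by exists U, (mxsimple_module simU); apply/submod_mx_irr.
Qed.

Section AbelianTypes.

Variables (gT : finGroupType) (G : {group gT}) (n : nat) (x s t : gT).
Hypotheses (hn : (3 <= n)%N) (H : hol_gens G n x s t).

Let Gx : x \in G := hg_x H.
Let Gs : s \in G := hg_s H.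
Let Gt : t \in G := hg_t H.

Local Notation htype := (@has_type gT G n x s t _ _).

Lemma abelian_type_deg1 (C : numClosedFieldType) d (r : mx_representation C G d)
    i : mx_irreducible r -> htype r (inl i) -> d = 1%N.
Proof.
move=> irr ri; apply: (der_sub_rker_deg1 irr).
by apply/(der_sub_rker hn H (neqN11 C) irr); exists i.
Qed.

(** The characteristic polynomial of [r s] is a positive power of [Psi rat j], so [l s] is an
    eigenvalue. Since [x] and [t] act by the same signs in [r] and [l], an eigenvector for [s]
    serves the whole group. *)
Lemma abelian_type_eigenvector (C : numClosedFieldType) d
    (r : mx_representation rat G d) (l : mx_representation C G 1) i :
  (0 < d)%N -> htype r (inl i) -> htype l (inl i) ->
  exists2 v : 'rV[C]_d, v != 0 & forall g, g \in G ->
    v *m map_repr ratr r g = l g 0 0 *: v.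
Proof.
case: d r => // d r _; case: i => [[e b] j] [xe tb sj] [lx lt ls].
have [v vs v0] : exists2 v : 'rV[C]_d.+1,
    v *m map_repr ratr r s = l s 0 0 *: v & v != 0.
  apply/eigenvalueP; rewrite map_reprE eigenvalue_root_char -map_char_poly.
  have [m Dm] := char_poly_irreducible (ratr : {rmorphism rat -> C})
    (Psi_irreducible j) (Psi_monic _ j) ((horner_mx_Psi (r s) j).2 sj).
  have m0 : (0 < m)%N.
    case: m Dm => // E; have := size_char_poly (r s).
    by rewrite E expr0 size_poly1.
  rewrite Dm rmorphXn rootE horner_exp expf_eq0 m0 /=; apply/eqP/eqP.
  rewrite map_Psi; apply/root_Psi.
  have E11 : l s = (l s 0 0)%:M by rewrite [LHS]mx11_scalar.
  case: (nat_of_ord j) ls => [|j'] /=; first by move->; rewrite mxE eqxx.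
  rewrite E11 -rmorphXn /= => /matrixP /(_ 0 0).
  by rewrite !mxE !eqxx.
have vX g m : g \in G -> v *m map_repr ratr r g = l g 0 0 *: v ->
    v *m map_repr ratr r (g ^+ m)%g = l (g ^+ m)%g 0 0 *: v.
  move=> Gg vg; elim: m => [|m IH].
    by rewrite !repr_mx1 mulmx1 mxE eqxx scale1r.
  rewrite expgS !repr_mxM ?groupX // mulmxA vg -scalemxAl IH scalerA.
  by rewrite mxE big_ord1.
have vM g h : g \in G -> h \in G -> v *m map_repr ratr r g = l g 0 0 *: v ->
    v *m map_repr ratr r h = l h 0 0 *: v ->
    v *m map_repr ratr r (g * h)%g = l (g * h)%g 0 0 *: v.
  move=> Gg Gh vg vh; rewrite !repr_mxM // mulmxA vg -scalemxAl vh scalerA.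
  by rewrite mxE big_ord1.
have vbool g (c : bool) : g \in G -> ord2 c (r g) -> ord2 c (l g) ->
    v *m map_repr ratr r g = l g 0 0 *: v.
  move=> Gg rg lg; rewrite map_reprE (ord2_bool rg) (ord2_bool lg).
  by case: c {rg lg}; rewrite ?expr0 ?expr1 ?map_mxN ?map_mx1 ?mulmxN mulmx1
    !mxE eqxx
    ?scaleN1r ?scale1r.
exists v => // g /(hg_gen H)[a [b' [c ->]]].
apply: (vM); rewrite ?groupM ?groupX //; last exact: vX.
apply: (vM); rewrite ?groupX //; first by apply: (vX) => //;
  exact: (vbool _ _ _ xe lx).
by apply: (vX) => //; exact: (vbool _ _ _ tb lt).
Qed.

End AbelianTypes.

(** * Isomorphism, constituent and Galois classes as type classes *)

Section TypeClasses.

Variables (gT : finGroupType) (G : {group gT}) (n : nat) (x s t : gT).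
Hypotheses (hn : (3 <= n)%N) (H : hol_gens G n x s t).

Let Gx : x \in G := hg_x H.
Let Gs : s \in G := hg_s H.
Let Gt : t \in G := hg_t H.

Local Notation htype := (@has_type gT G n x s t _ _).

Definition type_class (F : fieldType) (i : hol_type n) : set (rep F G) :=
  [set rho | irr_reps rho /\ htype rho i].

Lemma type_class_uniq (F : numFieldType) (rho : rep F G) i i' :
  type_class i rho -> type_class i' rho -> i = i'.
Proof.
move=> [irr ri] [_ ri']; have [d0 _] := (mx_irrP _).1 irr.
exact: (has_type_uniq hn H d0 (neqN11 F) ri ri').
Qed.

Lemma iso_class_type (rho : rep rat G) i :
  type_class i rho -> iso_class rho = type_class i.
Proof.
move=> [irr ri]; apply/seteqP; split=> rho' /=.
  move=> sim; split; first exact: (mx_rsim_irr sim).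
  exact: (has_type_rsim H (mx_rsim_sym sim)).
by move=> [irr' ri']; apply: (has_type_inj hn H irr irr' ri ri').
Qed.

Lemma type_class_neq0 (i : hol_type n) :
  exists rho : rep rat G, type_class i rho.
Proof. by have [d [r [irr ri]]] := has_type_exists hn H i; exists (Rep r). Qed.

Lemma type_class_inj : injective (@type_class rat).
Proof.
move=> i i' E; have [rho ri] := type_class_neq0 i.
by apply: (type_class_uniq ri); rewrite -E.
Qed.

(** A property of representations that depends only on the type turns the counting of classes into
    the counting of types. *)
Lemma irr_classesE (P : set (rep rat G)) (Q : set (hol_type n)) :
  (forall rho i, type_class i rho -> P rho <-> Q i) ->
  irr_classes P = (@type_class rat) @` Q.
Proof.
move=> PQ; apply/seteqP; split=> X.
  move=> [rho [irr Prho] <-]; have [i ri] := irr_has_type hn H irr.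
  by exists i; rewrite ?(iso_class_type (i := i)) //; apply/(PQ rho).
move=> [i Qi <-]; have [rho ri] := type_class_neq0 i.
exists rho; last exact: iso_class_type.
by split; [case: ri | apply/(PQ rho i)].
Qed.

Lemma card_irr_classes (P : set (rep rat G)) (Q : set (hol_type n)) :
  (forall rho i, type_class i rho -> P rho <-> Q i) -> irr_classes P #= Q.
Proof.
by move=> /irr_classesE ->; apply: inj_card_eq => i i' _ _;
  apply: type_class_inj.
Qed.

Lemma ker_contains_type (F : numFieldType) (rho : rep F G) i :
  type_class i rho -> ker_contains (G^`(1))%g rho <-> range inl i.
Proof.
move=> ri; have [irr hi] := ri.
rewrite /ker_contains /= (der_sub_rker hn H (neqN11 _) irr); split=> -[i'].
  by move=> hi'; exists i' => //; apply: (type_class_uniq (rho := rho)) ri.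
by move=> _ E; exists i'; rewrite E.
Qed.

Variable R : realType.
Local Notation C := R[i].

Lemma rep_trace1 (r : mx_representation C G 1) g : \tr (r g) = r g 0 0.
Proof. by rewrite /mxtrace big_ord1. Qed.

(** Constituents inherit the type from the complexification. Conversely, a complex representation of
    this type has degree 1 and is realised on the line of a common eigenvector. *)
Lemma complex_constituents_type (rho : rep rat G) i :
  type_class (inl i) rho ->
  complex_constituents R (iso_class rho) = type_class (inl i).
Proof.
move=> ri; have [irr hi] := ri; apply/seteqP; split=> sigma.
  move=> [rho']; rewrite (iso_class_type ri) => -[_ hi'] [irr_s [U [modU sim]]].
  split=> //; apply: (has_type_rsim H sim).
  apply: (has_type_sub H (B := val_submod 1%:M) (r2 := complexify R rho')).
  - by rewrite /row_free val_submod1.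
  - move=> g Gg; rewrite -[RHS](val_submodJ modU) // mul1mx -val_submodE //.
  - exact: (has_type_map H).
move=> [irr_s hs]; have := abelian_type_deg1 hn H irr_s hs.
case: sigma irr_s hs => d l /= irr_s hs d1; rewrite {d}d1 in l irr_s hs *.
exists rho; first by rewrite (iso_class_type ri).
split=> //; have [d0 _] := (mx_irrP _).1 irr.
have [v v0 vE] := abelian_type_eigenvector H d0 hi hs.
have modU : mxmodule (complexify R rho) <<v>>%MS.
  apply/mxmoduleP => g Gg; rewrite (eqmxMr _ (genmxE v)) genmxE /= vE //.
  exact: scalemx_sub.
exists <<v>>%MS, modU.
have vU : (v <= <<v>>)%MS by rewrite genmxE.
have rk1 : \rank <<v>>%MS = 1%N by rewrite genmxE rank_rV v0.
exists (in_submod <<v>>%MS v) => //.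
  by rewrite -row_leq_rank lt0n mxrank_eq0 -val_submod_eq0 in_submodK.
move=> g Gg; apply: val_submod_inj;
  rewrite [RHS]val_submodJ // in_submodK // vE //.
by rewrite {1}[l g]mx11_scalar mul_scalar_mx linearZ /= in_submodK.
Qed.

Lemma complex_type_neq0 i :
  exists2 l : rep C G, rep_deg l = 1%N & type_class (inl i) l.
Proof.
have [rho [irr hi]] := type_class_neq0 (inl i);
  have [d0 _] := (mx_irrP _).1 irr.
have [U [modU irrU]] := irr_submod_exists (complexify R rho) d0.
have hU : htype (submod_repr modU) (inl i).
  apply: (has_type_sub H (B := val_submod 1%:M) (r2 := complexify R rho)).
  - by rewrite /row_free val_submod1.
  - by move=> g Gg; rewrite -[RHS](val_submodJ modU) // mul1mx -val_submodE.
  - exact: (has_type_map H).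
exists (Rep (submod_repr modU)) => //; exact: (abelian_type_deg1 hn H irrU hU).
Qed.

Lemma deg1_ord2 (r : mx_representation C G 1) g j :
  ord2 j (r g) -> ord2 j (r g 0 0).
Proof.
have E : r g = (r g 0 0)%:M by apply: mx11_scalar.
case: j => [|j] /=; first by move->; rewrite mxE eqxx.
by rewrite {1}E -rmorphXn /= => /matrixP /(_ 0 0); rewrite !mxE !eqxx.
Qed.

(** The polynomial depends on the type and on [g], not on [r]: each value is a fixed sign times a
    fixed power of the value at [s]. *)
Lemma deg1_charE e b j g : g \in G -> exists p : {poly rat},
  forall r : mx_representation C G 1, htype r (inl (e, b, j)) ->
    r g 0 0 = (map_poly ratr p).[r s 0 0].
Proof.
move=> /(hg_gen H)[a [b' [c ->]]].
exists ((-1) ^+ (e * a + b * b') *: 'X^c) => r [rx rt rs].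
have -> : r (x ^+ a * t ^+ b' * s ^+ c)%g =
    ((r x 0 0) ^+ a * (r t 0 0) ^+ b' * (r s 0 0) ^+ c)%:M.
  rewrite !repr_mxM ?groupM ?groupX // !repr_mx_expg //.
  by rewrite 2!rmorphM !rmorphXn /= -!mx11_scalar !mulmxE.
rewrite (ord2_bool (deg1_ord2 rx)) (ord2_bool (deg1_ord2 rt)) mxE eqxx mulr1n.
rewrite map_polyZ map_polyXn hornerZ hornerXn rmorphXn rmorphN1.
by rewrite exprD !exprM.
Qed.

(** Conjugation fixes the rational values [1] and [-1] that define the type. Conversely, two
    characters of one type are related by the map of [gal_conj_exists] between their values at
    [s]. *)
Lemma galois_class_type (l : rep C G) i :
  rep_deg l = 1%N -> type_class (inl i) l ->
  galois_class l = type_class (inl i).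
Proof.
case: l => d l /= d1; rewrite {d}d1 in l *; move=> [_ /=].
case: i => [[e b] j] [lx lt ls]; apply/seteqP; split=> -[d r] /=.
  move=> [irr [f [_ _ _ fq] fE]]; split=> //.
  have d1 : d = 1%N.
    have := fE 1%g (group1 G); rewrite /rep_char /= !repr_mx1 !mxtrace1.
    rewrite -[1 in RHS](rmorph1 (ratr : {rmorphism rat -> C})) fq rmorph1.
    by move/eqP; rewrite pnatr_eq1 => /eqP.
  rewrite {d}d1 in r irr fE *.
  have rq g (q : rat) : g \in G -> l g = (ratr q)%:M -> r g = (ratr q)%:M.
    move=> Gg lq; have := fE g Gg;
      rewrite /rep_char /= !rep_trace1 lq mxE eqxx mulr1n fq => rq.
    by rewrite [LHS]mx11_scalar rq.
  have ordr g j' : g \in G -> ord2 j' (l g) -> ord2 j' (r g).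
    move=> Gg; case: j' => [|j'] /=.
      by move=> lg; rewrite (rq g 1) ?rmorph1.
    rewrite -!repr_mx_expg // => lg; rewrite (rq _ (-1)) ?groupX //.
      by rewrite rmorphN1 raddfN.
    by rewrite lg rmorphN1 raddfN.
  by split; apply: ordr.
move=> [irr [rx rt rs]].
have d1 : d = 1%N by apply: (abelian_type_deg1 hn H (i := (e, b, j)) irr).
rewrite {d}d1 in r irr rx rt rs *; split=> //.
have [f f_gal fE] := gal_conj_exists (deg1_ord2 ls) (deg1_ord2 rs).
exists f.
  (* All values are polynomials in the value at [s], which is itself a value, so it generates the
     character field. *)
  suff -> : char_field G (rep_char (Rep l)) = adjoin (l s 0 0) by [].
  apply/seteqP; split.
    apply: smallest_sub; first exact: (adjoin_divring_closed (deg1_ord2 ls)).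
    move=> _ [g /= Gg <-]; rewrite /rep_char /= rep_trace1.
    by have [p pE] := deg1_charE e b j Gg; exists p; apply: pE.
  move=> a az K [K_div subK]; apply: (adjoin_min K_div) az.
  by apply/mem_set/subK; exists s => //=; rewrite /rep_char /= rep_trace1.
move=> g Gg; rewrite /rep_char /= !rep_trace1.
by have [p pE] := deg1_charE e b j Gg; rewrite !pE.
Qed.

End TypeClasses.

(** * Counting the types *)

Lemma card_finType (T : finType) : [set: T] #= `I_#|T|.
Proof.
apply: (card_eq_trans _ (card_esym card_II)).
rewrite -(_ : enum_rank @` [set: T] = [set: 'I_#|T|]).
  by apply: card_esym; apply: inj_card_eq => a b _ _; apply: enum_rank_inj.
by apply/seteqP; split=> // i _; exists (enum_val i); rewrite ?enum_valK.
Qed.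

Lemma card_abelian_types (n : nat) :
  #|{: bool * bool * 'I_n.-1}| = (4 * (n - 1))%N.
Proof. by rewrite !card_prod card_bool card_ord subn1. Qed.

Lemma card_nonabelian_types (n : nat) :
  #|{: {k : 'I_n.-1 & 'I_k.+1}}| = ((n * (n - 1)) %/ 2)%N.
Proof.
rewrite card_tagged sumnE big_map big_enum /=.
under eq_bigr do rewrite card_ord.
have sum2 m : ((\sum_(k < m) k.+1) * 2 = m.+1 * m)%N.
  by elim: m => [|m IH]; rewrite ?big_ord0 // big_ord_recr /= mulnDl IH; lia.
by case: n => [|n] /=; rewrite ?big_ord0 // subn1 -sum2 mulnK.
Qed.

Lemma Cyclotomic_pow2_inj i j : 'Phi_(2 ^ i) = 'Phi_(2 ^ j) -> i = j.
Proof.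
move=> E; have [z prim_z] := C_prim_root_exists (expn_gt0 2 i).
have [z' prim_z'] := C_prim_root_exists (expn_gt0 2 j).
apply: (ord2_uniq (neqN11 algC) (prim_root_ord2 (neqN11 _) prim_z)).
apply: (prim_root_ord2 (neqN11 _)); rewrite -(root_cyclotomic prim_z').
by rewrite -(Cintr_Cyclotomic prim_z') -E (Cintr_Cyclotomic prim_z)
  root_cyclotomic.
Qed.

(** The first component of a pair is [n] minus the index in the type, so [2 <= k <= n] becomes an
    index below [n.-1] and [j <= n - k] becomes ['I_k.+1]. *)
Lemma card_Cyclotomic_pairs (n : nat) : (3 <= n)%N ->
  [set kp : nat * {poly int} | (2 <= kp.1 <= n)%N /\
    exists2 j, (j <= n - kp.1)%N & kp.2 = 'Phi_(2 ^ j)] #=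
  [set: {k : 'I_n.-1 & 'I_k.+1}].
Proof.
move=> hn.
pose f (kj : {k : 'I_n.-1 & 'I_k.+1}) := ((n - tag kj)%N, 'Phi_(2 ^ tagged kj)).
rewrite (_ : [set kp | _] = f @` setT).
  apply: inj_card_eq => -[k j] [k' j'] _ _ [/= Ek /Cyclotomic_pow2_inj Ej].
  have {Ek} Ek : k = k' by apply: val_inj => /=; have := ltn_ord k;
    have := ltn_ord k'; lia.
  by case: k' / Ek j' Ej => j' Ej; congr existT; apply: val_inj.
apply/seteqP; split=> [[k p] /= [k2n [j jk ->]]|_ [[k j] _ <-] /=].
  have kn : (n - k < n.-1)%N by lia.
  exists (Tagged (fun k : 'I_n.-1 => 'I_k.+1)
    (Ordinal (jk : j < (Ordinal kn).+1)%N)) => //.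
  by rewrite /f /= subKn //; lia.
split; first by have := ltn_ord k; lia.
by exists j => //; rewrite subKn -1?ltnS //; have := ltn_ord k; lia.
Qed.

Local Open Scope nat_scope.

Theorem theorem9p2p2 (R : realType) (n : nat) (hn : 3 <= n) :
  let G := HolC (2 ^ n) in
  let over_G' : set (rep rat G) := ker_contains (G^`(1))%g in
  [/\ set_bij (irr_classes over_G') (degree1_galois_classes R G)
        (complex_constituents R)
      /\ irr_classes over_G' #= `I_(4 * (n - 1)),
      irr_classes (~` over_G') #=
        [set kp : nat * {poly int} |
          2 <= kp.1 <= n /\ exists2 j, j <= n - kp.1 & kp.2 = 'Phi_(2 ^ j)]
    & irr_classes ([set: rep rat G]) #= `I_(4 * (n - 1) + (n * (n - 1)) %/ 2)].
Proof.
move=> G over_G'; have [x [s [t H]]] := HolC_gens hn; rewrite -/G in H.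
have over_type := ker_contains_type hn H.
(* Taking constituents preserves the type, so the bijection is checked on types. *)
have over_classE X : irr_classes over_G' X ->
  exists2 i, X = type_class x s t (inl i : hol_type n) &
    complex_constituents R X = type_class x s t (inl i : hol_type n).
  move=> [rho [irr rho_over] <-]; have [i ri] := irr_has_type hn H irr.
  have [i' _ Ei] := (over_type _ rho i (conj irr ri)).1 rho_over.
  have ri' : type_class x s t (inl i' : hol_type n) rho by rewrite Ei.
  by exists i'; [apply: (iso_class_type hn H) | apply:
    (complex_constituents_type hn H)].
split; first split.
- split.
  + move=> X /over_classE[i _ ->]; have [l l1 li] := complex_type_neq0 hn H R i.
    by exists l => //; apply: (galois_class_type hn H).
  (* Two equal images share a complex representation, which has only one type. *)
  + move=> X Y /set_mem/over_classE[i -> ->] /set_mem/over_classE[i' -> ->] E.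
    have [l l1 li] := complex_type_neq0 hn H R i.
    by congr type_class; apply: (type_class_uniq hn H li); rewrite -E.
  (* A degree 1 representation kills the derived group, so its type is abelian, and that type occurs
     over the rationals. *)
  + move=> _ [l l1 <-]; have irr := deg1_irr (rep_mx l) l1.
    have [i li] := irr_has_type hn H irr.
    have [] := (over_type _ l i (conj irr li)).1; first exact: rker_linear.
    move=> i' _ Ei;
    have li' : type_class x s t (inl i' : hol_type n) l by rewrite Ei.
    have [rho ri] := type_class_neq0 hn H (inl i').
    exists (iso_class rho).
      by exists rho => //; split; [case: ri | apply/(over_type _ rho _ ri);
        exists i'].
    by rewrite (complex_constituents_type hn H R ri) (galois_class_type hn H
      l1 li').
- apply: (card_eq_trans (card_irr_classes hn H (over_type _))).
  rewrite -card_abelian_types; apply: card_eq_trans (card_finType _).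
  by apply: inj_card_eq => a b _ _ [].
- apply: card_eq_trans (card_esym (card_Cyclotomic_pairs hn)).
  have Q rho (i : hol_type n) :
    type_class x s t i rho -> (~` over_G') rho <-> range inr i.
    move=> /(over_type _ rho) [to_inl of_inl];
      case: i to_inl of_inl => i to_inl of_inl.
      by split=> [no|[]//]; case: no; apply: of_inl; exists i.
    by split=> [_|_ /to_inl[]//]; exists i.
  apply: (card_eq_trans (card_irr_classes hn H Q)).
  by apply: inj_card_eq => a b _ _ [].
- have Q rho (i : hol_type n) :
    type_class x s t i rho -> [set: rep rat G] rho <-> [set: hol_type n] i
    by [].
  apply: (card_eq_trans (card_irr_classes hn H Q)).
  rewrite -card_abelian_types -card_nonabelian_types -card_sum.
  exact: card_finType.
Qed.
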